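(* Let $N\ge 2$ and let $\Phi=\{\varphi_i\}_{i=1}^M$ be a unit norm frame for $\mathbb{R}^N$. Then $$\frac{N(1-D_\Phi^2)}{N-D_\Phi^2}\le V_\Phi^{4/N}\le\frac{N(N-1-D_\Phi^2)}{(N-1)(N-D_\Phi^2)}\le 1,$$ where the leftmost inequality requires $D_\Phi<1$. Consequently, $V_\Phi\to 1$ is equivalent to $D_\Phi\to 0$; that is, for any sequence $(\Phi_n)_{n}$ of unit norm frames of $M$ vectors in $\mathbb{R}^N$, $V_{\Phi_n}\to 1$ if and only if $D_{\Phi_n}\to 0$.
   Context: A sequence $\Phi=\{\varphi_i\}_{i=1}^M\subset\mathbb{R}^N$ is a frame if there are $0<A\le B<\infty$ with $A\|x\|^2\le\sum_{i=1}^M|\langle x,\varphi_i\rangle|^2\le B\|x\|^2$ for all $x\in\mathbb{R}^N$; it is unit norm if $\|\varphi_i\|_2=1$ for all $i$. For a unit norm frame $\Phi$: $$D_\Phi=\min_{c_1,\dots,c_M\ge 0}\Big\|\sum_{i=1}^M c_i\varphi_i\varphi_i^T-I\Big\|_F,$$ where $\|\cdot\|_F$ is the Frobenius norm and $I$ the $N\times N$ identity. An ellipsoid in $\mathbb{R}^N$ is a set $E(X,c)=\{v:\langle X(v-c),v-c\rangle\le 1\}$ with $X$ positive definite and $c\in\mathbb{R}^N$. The minimal ellipsoid $E_\Phi$ is the unique ellipsoid of minimal volume containing the convex hull of $\{\varphi_i\}_{i=1}^M\cup\{-\varphi_i\}_{i=1}^M$, and $V_\Phi=\mathrm{Vol}(E_\Phi)/\omega_N$,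 where $\omega_N$ is the volume of the unit ball in $\mathbb{R}^N$. *)

(* Defs.v *)
From HB Require Import structures.
From mathcomp Require Import all_boot all_order all_algebra.
From mathcomp Require Import all_classical all_reals all_analysis.
Import Order.TTheory GRing.Theory Num.Theory.
Import numFieldNormedType.Exports.

Set Implicit Arguments.
Unset Strict Implicit.
Unset Printing Implicit Defensive.

Local Open Scope classical_set_scope.
Local Open Scope ring_scope.

(* The Euclidean structure of R^n, on column vectors. The norm `|v| that the
   library puts on matrices is the sup norm, hence the definitions below. *)
Definition dot (R : realType) (n : nat) (x y : 'cV[R]_n) : R :=
  \sum_i x i 0 * y i 0.

Definition norm2 (R : realType) (n : nat) (x : 'cV[R]_n) : R :=
  Num.sqrt (dot x x).

Definition normF (R : realType) (m n : nat) (A : 'M[R]_(m, n)) : R :=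
  Num.sqrt (\sum_i \sum_j A i j ^+ 2).

Definition is_frame (R : realType) (N M : nat) (Phi : 'I_M -> 'cV[R]_N) : Prop :=
  exists A B : R, [/\ 0 < A, A <= B &
    forall x : 'cV[R]_N,
      A * norm2 x ^+ 2 <= \sum_i `|dot x (Phi i)| ^+ 2 <= B * norm2 x ^+ 2].

Definition unit_norm (R : realType) (N M : nat) (Phi : 'I_M -> 'cV[R]_N) : Prop :=
  forall i, norm2 (Phi i) = 1.

Definition unit_norm_frame (R : realType) (N M : nat)
    (Phi : 'I_M -> 'cV[R]_N) : Prop :=
  is_frame Phi /\ unit_norm Phi.

(* The minimum is an attained lower bound; the value 0 is a default, used
   only for a set without minimum. *)
Definition minimum (R : realType) (S : set R) : R :=
  xget 0 (S `&` lbound S).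

Definition frameD (R : realType) (N M : nat) (Phi : 'I_M -> 'cV[R]_N) : R :=
  minimum [set normF (\sum_i c i *: (Phi i *m (Phi i)^T) - 1%:M)
          | c in [set c : 'I_M -> R | forall i, 0 <= c i]].

(* An alias of \x, which the library equips with the structure of a measure
   but not with that of a sigma-finite measure. *)
Definition product_measure (R : realType) (d1 d2 : measure_display)
    (T1 : measurableType d1) (T2 : measurableType d2)
    (m1 : {sigma_finite_measure set T1 -> \bar R})
    (m2 : {sigma_finite_measure set T2 -> \bar R}) :
  set (T1 * T2)%type -> \bar R := (m1 \x m2)%E.

HB.instance Definition _ (R : realType) (d1 d2 : measure_display)
    (T1 : measurableType d1) (T2 : measurableType d2)
    (m1 : {sigma_finite_measure set T1 -> \bar R})
    (m2 : {sigma_finite_measure set T2 -> \bar R}) :=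
  Measure.on (product_measure m1 m2).

Lemma product_measure_sigma_finite (R : realType) (d1 d2 : measure_display)
    (T1 : measurableType d1) (T2 : measurableType d2)
    (m1 : {sigma_finite_measure set T1 -> \bar R})
    (m2 : {sigma_finite_measure set T2 -> \bar R}) :
  sigma_finite setT (product_measure m1 m2).
Proof.
have /sigma_finiteP[F [TF ndF Foo]] := sigma_finiteT m1.
have /sigma_finiteP[G [TG ndG Goo]] := sigma_finiteT m2.
exists (fun n => F n `*` G n).
 rewrite -setXTT TF TG predeqE => -[x y]; split.
    move=> [/= [n _ Fnx] [k _ Gky]]; exists (maxn n k) => //; split.
    - by move: x Fnx; exact/subsetPset/ndF/leq_maxl.
    - by move: y Gky; exact/subsetPset/ndG/leq_maxr.
  by move=> [n _ []/= ? ?]; split; exists n.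
move=> k; have [? ?] := Foo k; have [? ?] := Goo k.
split; first exact: measurableX.
by rewrite /product_measure product_measure1E// lte_mul_pinfty// ge0_fin_numE.
Qed.

HB.instance Definition _ (R : realType) (d1 d2 : measure_display)
    (T1 : measurableType d1) (T2 : measurableType d2)
    (m1 : {sigma_finite_measure set T1 -> \bar R})
    (m2 : {sigma_finite_measure set T2 -> \bar R}) :=
  Measure_isSigmaFinite.Build _ _ _ (product_measure m1 m2)
    (product_measure_sigma_finite m1 m2).

Record sigma_finite_space (R : realType) := SigmaFiniteSpace {
  sfs_disp : measure_display;
  sfs_type : measurableType sfs_disp;
  sfs_measure : {sigma_finite_measure set sfs_type -> \bar R} }.

(* R^n as the iterated product R * (R * ( .. * unit)), with the product
   sigma-algebra and the product of n copies of the Lebesgue measure of R. *)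
Fixpoint lebesgue_space (R : realType) (n : nat) : sigma_finite_space R :=
  if n is k.+1 then
    let S := lebesgue_space R k in
    SigmaFiniteSpace (product_measure (@lebesgue_measure R) (sfs_measure S))
  else SigmaFiniteSpace (@dirac _ unit tt R).

Fixpoint lebesgue_point (R : realType) (n : nat) :
    'cV[R]_n -> sfs_type (lebesgue_space R n) :=
  if n is k.+1 return 'cV[R]_n -> sfs_type (lebesgue_space R n) then
    fun v => (v 0 0, lebesgue_point (\col_i v (lift ord0 i) 0))
  else fun=> tt.

(* N-dimensional volume: the product measure, transported along the
   identification of column vectors with iterated pairs. *)
Definition vol (R : realType) (n : nat) (A : set 'cV[R]_n) : \bar R :=
  sfs_measure (lebesgue_space R n) (@lebesgue_point R n @` A).

Definition unit_ball (R : realType) (n : nat) : set 'cV[R]_n :=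
  [set v | norm2 v <= 1].

Definition positive_definite (R : realType) (n : nat) (X : 'M[R]_n) : Prop :=
  X^T = X /\ forall v : 'cV[R]_n, v != 0 -> 0 < dot (X *m v) v.

Definition ellipsoid (R : realType) (n : nat) (X : 'M[R]_n) (c : 'cV[R]_n) :
    set 'cV[R]_n :=
  [set v | dot (X *m (v - c)) (v - c) <= 1].

Definition is_ellipsoid (R : realType) (n : nat) (E : set 'cV[R]_n) : Prop :=
  exists X c, positive_definite X /\ E = ellipsoid X c.

Definition sym_hull (R : realType) (N M : nat) (Phi : 'I_M -> 'cV[R]_N) :
    set 'cV[R]_N :=
  smallest (@convex_set R 'cV[R]_N)
    (range Phi `|` range (fun i => - Phi i)).

Definition is_minimal_ellipsoid (R : realType) (N M : nat)
    (Phi : 'I_M -> 'cV[R]_N) (E : set 'cV[R]_N) : Prop :=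
  [/\ is_ellipsoid E, sym_hull Phi `<=` E &
      forall E', is_ellipsoid E' -> sym_hull Phi `<=` E' -> (vol E <= vol E')%E].

(* set0 is a default value, used only if there is no minimal ellipsoid. *)
Definition minimal_ellipsoid (R : realType) (N M : nat)
    (Phi : 'I_M -> 'cV[R]_N) : set 'cV[R]_N :=
  xget set0 (is_minimal_ellipsoid Phi).

Definition frameV (R : realType) (N M : nat) (Phi : 'I_M -> 'cV[R]_N) : R :=
  fine (vol (minimal_ellipsoid Phi)) / fine (vol (@unit_ball R N)).

(* Main.v *)
Require Import Defs.
From mathcomp Require Import all_boot all_order all_algebra.
From mathcomp Require Import all_classical all_reals all_analysis.
From mathcomp Require Import measurable_realfun.
From mathcomp Require Import ring lra complex.
Import Order.TTheory GRing.Theory Num.Theory.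
Import numFieldNormedType.Exports.

Set Implicit Arguments.
Unset Strict Implicit.
Unset Printing Implicit Defensive.

Local Open Scope classical_set_scope.
Local Open Scope ring_scope.

(** Write V and D for the normalized volume and the distance attached to the
    frame (phi_i), and |A| for the Frobenius norm of a matrix A. Both V and D are
    optimal values over the cone of matrices sum_i c_i phi_i phi_i^T with c >= 0,
    and the inequalities compare the two optimizers.

    Volume. Among the c >= 0 with sum c = N let Y be a matrix
    sum_i c_i phi_i phi_i^T of maximal determinant. Moving c towards a vertex of
    the simplex cannot increase the determinant, which to first order says
    <Y^-1 phi_i, phi_i> <= 1 for all i ([max_det_leverage]): the ellipsoid of
    Y^-1 centred at 0 contains all the vectors phi_i and - phi_i. Conversely, an
    ellipsoid of matrix X containing them satisfies <X phi_i, phi_i> <= 1, hence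
    tr (X Y) <= N, hence det X * det Y <= 1 by the inequality of arithmetic and
    geometric means ([pd_trace_det_le1]). As the volume of an ellipsoid is
    proportional to (det X)^(-1/2) ([vol_ellipsoid]), the ellipsoid of Y^-1 is
    minimal and V^2 = det Y ([frameV_det]).

    Distance. Scaling the optimal T = sum_i c_i phi_i phi_i^T by a factor a >= 0
    cannot bring it closer to I, so tr T = |T|^2 = N - D^2 ([frameD_trace]).
    Comparing with the multiples of Y gives D^2 <= N - N^2 / |Y|^2
    ([design_normF]).

    Upper bound. The latter inequality bounds the second elementary symmetric
    function ((tr Y)^2 - |Y|^2) / 2 of the eigenvalues of Y from above, and the
    inequality of means over the products of pairs of eigenvalues bounds det Y
    by it ([psd_sqr_det_le]).

    Lower bound. N / (N - D^2) *: T competes with Y, so it remains to bound det T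
    from below. The mean m of the eigenvalues of T and their variance are known.
    By Cauchy-Schwarz they all lie in some interval [m - r, m + r] with
    (m - r) (m + r) = m (1 - D^2), and m is its midpoint, so concavity of the
    logarithm on that interval gives (det T)^2 >= (m (1 - D^2))^N
    ([sqr_prod_ge]).

    The limit statement follows because the bounds force D^2 <= N^2 (1 - V^4),
    and because V <= 1 is bounded from below by a function of D continuous at 0
    with value 1. *)

(** * Spectra of real symmetric matrices *)

Local Open Scope complex_scope.
(** Over the complex numbers a real symmetric matrix is hermitian, hence unitarily
    diagonalizable with real eigenvalues; each of these is a root of the
    characteristic polynomial, and so has a real eigenvector. *)
Lemma real_spectrum (R : realType) (n : nat) (A : 'M[R]_n) : A^T = A ->
  exists d : 'I_n -> R,
    [/\ \det A = \prod_i d i, \tr A = \sum_i d i,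
        \tr (A *m A) = \sum_i d i ^+ 2 &
        forall i, exists2 v : 'cV[R]_n, v != 0 & A *m v = d i *: v].
Proof.
move=> AT; pose f : {rmorphism R -> R[i]} := real_complex R; pose AC := map_mx f A.
have ACh : AC \is hermsymmx.
  apply: realsym_hermsym.
    by apply/is_hermitianmxP; rewrite expr0 scale1r map_mx_id // /AC map_trmx AT.
  apply/mxOverP => i j; rewrite mxE; apply/complex_realP; by exists (A i j).
have AE := orthomx_spectralP (hermitian_normalmx ACh).
have Dr := mxOverP (hermitian_spectral_diag_real ACh).
set P := spectralmx AC in AE; set D := spectral_diag AC in AE Dr.
have Pu : P \in unitmx by exact: spectral_unit.
pose d i := complex.Re (D 0 i).
have dE i : f (d i) = D 0 i by apply: RRe_real.
exists d; split.
- apply: (@complexI R); apply: etrans (esym (det_map_mx f A)) _.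
  rewrite -/AC AE !det_mulmx.
  rewrite mulrAC -det_mulmx mulVmx // det1 mul1r det_diag -[RHS]/(f _) rmorph_prod.
  by apply: eq_bigr => i _; rewrite /= dE.
- apply: (@complexI R); apply: etrans (esym (trace_map_mx f A)) _; rewrite -/AC AE.
  rewrite mxtrace_mulC mulmxA mulmxV // mul1mx mxtrace_diag -[RHS]/(f _) rmorph_sum.
  by apply: eq_bigr => i _; rewrite /= dE.
- apply: (@complexI R); apply: etrans (esym (trace_map_mx f _)) _.
  rewrite map_mxM -/AC AE.
  rewrite -!mulmxA mxtrace_mulC !mulmxA mulmxK // mulmxK // mulmx_diag.
  rewrite mxtrace_diag -[RHS]/(f _) rmorph_sum.
  by apply: eq_bigr => i _; rewrite mxE /= -dE -expr2 rmorphXn.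
move=> i; have : eigenvalue A (d i).
  rewrite -(eigenvalue_map f) -/AC dE; apply/eigenvalueP.
  exists (row i P); last first.
    apply/negP => /eqP ri0; move: Pu; rewrite unitmxE (expand_det_row _ i).
    rewrite big1 ?unitr0 // => j _; move/rowP/(_ j): ri0; rewrite !mxE => ->.
    by rewrite mul0r.
  rewrite -row_mul [X in P *m X]AE !mulmxA mulmxV // mul1mx row_mul row_diag_mx.
  by rewrite -scalemxAl -rowE.
case/eigenvalueP => v vA v0; exists v^T.
  by apply: contra v0 => /eqP/(congr1 trmx); rewrite trmxK trmx0 => ->.
by rewrite -[A]AT -trmx_mul vA linearZ.
Qed.
Local Close Scope complex_scope.

(** * Inequalities between symmetric functions of real numbers *)

Lemma prod_le_mean_expn (R : realType) (n : nat) (d : 'I_n -> R) :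
  (forall i, 0 <= d i) -> \prod_i d i <= ((\sum_i d i) / n%:R) ^+ n.
Proof.
move=> d0; have := @leif_AGM R 'I_n predT d (fun i _ => d0 i).
by move=> /leifP; rewrite card_ord; case: ifP => [_ /eqP->|_ /ltW] //.
Qed.

Lemma prod_pairs (R : comNzRingType) (n : nat) (d : 'I_n -> R) :
  \prod_(p : 'I_n * 'I_n | p.1 != p.2) (d p.1 * d p.2)
    = (\prod_i d i) ^+ (2 * n.-1).
Proof.
have off (i : 'I_n) : #|[pred j | i != j]| = n.-1.
  by rewrite -[in RHS](card_ord n) -(cardC1 i); apply: eq_card => j; rewrite !inE eq_sym.
rewrite big_split /= mulnC exprM expr2 -!prodrXl; congr (_ * _).
  rewrite -(pair_big_dep predT (fun i j => i != j) (fun i j => d i)) /=.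
  apply: eq_bigr => i _.
  by rewrite (eq_bigl [in [pred j | i != j]]) ?prodr_const ?off.
rewrite -(pair_big_dep predT (fun i j => i != j) (fun i j => d j)) /=.
rewrite (exchange_big_dep predT) //=; apply: eq_bigr => i _.
rewrite (eq_bigl [in [pred j | i != j]]) ?prodr_const ?off // => j.
by rewrite !inE eq_sym.
Qed.

Lemma sum_pairs (R : comNzRingType) (n : nat) (d : 'I_n -> R) :
  \sum_(p : 'I_n * 'I_n | p.1 != p.2) (d p.1 * d p.2)
    = (\sum_i d i) ^+ 2 - \sum_i d i ^+ 2.
Proof.
rewrite expr2 mulr_suml.
under [X in X - _]eq_bigr do rewrite mulr_sumr.
rewrite -(pair_big_dep predT (fun i j => i != j) (fun i j => d i * d j)) /=.
rewrite -sumrB; apply: eq_bigr => i _.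
rewrite [in RHS](bigD1 i) //= -expr2 addrAC subrr add0r.
by apply: eq_bigl => j; rewrite eq_sym.
Qed.

(** This is the inequality of means for the n (n - 1) products d_i d_j with
    i <> j, whose product is the power 2 (n - 1) of that of the d_i; the
    root of order n - 1 is then taken. *)
Lemma sqr_prod_le (R : realType) (n : nat) (d : 'I_n -> R) : (1 < n)%N ->
  (forall i, 0 <= d i) ->
  (\prod_i d i) ^+ 2
    <= (((\sum_i d i) ^+ 2 - \sum_i d i ^+ 2) / (n%:R * (n%:R - 1))) ^+ n.
Proof.
move=> n1 d0; have n0 : (0 < n)%N by exact: ltnW.
set s := (X in X ^+ n).
have nn : (n%:R - 1 : R) = n.-1%:R by rewrite -subn1 natrB.
have cardpairs : #|[pred p : 'I_n * 'I_n | p.1 != p.2]| = (n * n.-1)%N.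
  rewrite -sum1_card.
  rewrite -(pair_big_dep predT (fun i j => i != j) (fun i j => 1%N)) /=.
  rewrite -[in RHS](card_ord n) -sum_nat_const; apply: eq_bigr => i _.
  rewrite sum1_card -(cardC1 i); apply: eq_card => j.
  by rewrite !inE eq_sym.
have := @leif_AGM R ('I_n * 'I_n)%type [pred p | p.1 != p.2]
  (fun p => d p.1 * d p.2) (fun p _ => mulr_ge0 (d0 _) (d0 _)).
rewrite cardpairs => -[+ _] /=; rewrite prod_pairs sum_pairs natrM -nn -/s.
rewrite !exprM => le; rewrite -(@ler_pXn2r _ n.-1) //.
- by rewrite ltn_predRL.
- by rewrite nnegrE exprn_ge0 // prodr_ge0.
rewrite nnegrE exprn_ge0 // /s mulr_ge0 //.
  by rewrite -sum_pairs sumr_ge0 // => p _; rewrite mulr_ge0.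
by rewrite invr_ge0 nn -natrM.
Qed.

Lemma sqr_sum_le (R : realType) (I : finType) (P : pred I) (x : I -> R) :
  (\sum_(i | P i) x i) ^+ 2 <= #|P|%:R * \sum_(i | P i) x i ^+ 2.
Proof.
have [P0|P0] := posnP #|P|.
  by rewrite !big_pred0 ?expr0n ?mulr0 //; exact: card0_eq.
set u := \sum_(i | P i) x i.
have : 0 <= \sum_(i | P i) (#|P|%:R * x i - u) ^+ 2.
  by apply: sumr_ge0 => i _; exact: sqr_ge0.
under eq_bigr do rewrite sqrrB exprMn.
rewrite big_split sumrB /= sumrMnl -mulr_suml -!mulr_sumr -/u sumr_const.
have P0R : 0 < #|P|%:R :> R by rewrite ltr0n.
rewrite -(mulr_natl u) => H; rewrite -(ler_pM2l P0R) -subr_ge0.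
by apply: le_trans H _; rewrite le_eqVlt; apply/orP; left; apply/eqP; ring.
Qed.

(** Concavity of the logarithm between m - r and m + r, multiplied by 2 r so that
    the degenerate case r = 0 is covered. *)
Lemma ln_ge_chord (R : realType) (m r t : R) : 0 < m - r -> `|t - m| <= r ->
  (m + r - t) * ln (m - r) + (t - m + r) * ln (m + r) <= 2 * r * ln t.
Proof.
move=> b0 tr; have r0 : 0 <= r by exact: le_trans tr.
move: tr; rewrite ler_norml => /andP[tl tu].
have [r_eq0|rn0] := eqVneq r 0.
  move: tl tu b0; rewrite r_eq0 oppr0 => tl tu _.
  have -> : t = m by lra.
  by rewrite !addr0 subrr !mul0r mulr0 !mul0r addr0.
have rgt0 : 0 < r by rewrite lt_def rn0.
set s := (m + r - t) / (2 * r).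
have s0 : 0 <= s by rewrite /s divr_ge0 //; lra.
have s1 : s <= 1 by rewrite /s ler_pdivrMr ?mulr_gt0 //; lra.
have b'0 : 0 < m + r by lra.
have le : s * ln (m - r) + (1 - s) * ln (m + r)
    <= ln (s * (m - r) + (1 - s) * (m + r)).
  exact: (@concave_ln R (Itv01 s0 s1) _ _ b0 b'0).
have {}le : s * ln (m - r) + (1 - s) * ln (m + r) <= ln t.
  by apply: le_trans le _; rewrite le_eqVlt; apply/orP; left; apply/eqP;
     congr ln; rewrite /s; field.
have r2 : 0 < 2 * r by rewrite mulr_gt0.
move: le; rewrite -(ler_pM2l r2); apply: le_trans.
by rewrite le_eqVlt; apply/orP; left; apply/eqP; rewrite /s; field.
Qed.

Lemma ln_prod (R : realType) (n : nat) (d : 'I_n -> R) :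
  (forall i, 0 < d i) -> ln (\prod_i d i) = \sum_i ln (d i).
Proof.
elim: n d => [|n IH] d d0; first by rewrite !big_ord0 ln1.
by rewrite !big_ord_recl lnM ?posrE ?prodr_gt0 // IH.
Qed.

(** The hypotheses fix the mean m = (n - D2) / n of the d_i and their variance
    m - m^2. The deviations sum to 0, so Cauchy-Schwarz applied to all of them
    but one bounds the last one by r, where r^2 = (n - 1) (m - m^2). On the
    interval [m - r, m + r] the logarithm lies above its chord, whose average over
    the d_i is its value at the midpoint m, that is, the mean of ln (m - r) and
    ln (m + r); and (m - r) (m + r) = m (1 - D2). The interval is positive because
    D2 < 1. *)
Lemma sqr_prod_ge (R : realType) (n : nat) (d : 'I_n -> R) (D2 : R) :
  (0 < n)%N -> 0 <= D2 < 1 ->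
  \sum_i d i = n%:R - D2 -> \sum_i d i ^+ 2 = n%:R - D2 ->
  ((n%:R - D2) / n%:R * (1 - D2)) ^+ n <= (\prod_i d i) ^+ 2
    /\ 0 < \prod_i d i.
Proof.
move=> n0 /andP[D0 D1] s1 s2; set m := (n%:R - D2) / n%:R.
have nR : 1 <= n%:R :> R by rewrite ler1n.
have nn0 : n%:R != 0 :> R by rewrite pnatr_eq0 -lt0n.
have mn : m * n%:R = n%:R - D2 by rewrite /m divfK.
have m0 : 0 < m by rewrite /m divr_gt0 //; lra.
have m1 : m <= 1 by rewrite /m ler_pdivrMr; lra.
set r := Num.sqrt ((n%:R - 1) * (m - m ^+ 2)).
have rad0 : 0 <= (n%:R - 1) * (m - m ^+ 2).
  by rewrite mulr_ge0 ?subr_ge0 // expr2 ler_piMl // ltW.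
have r2 : r ^+ 2 = (n%:R - 1) * (m - m ^+ 2) by rewrite sqr_sqrtr.
have r0 : 0 <= r by exact: sqrtr_ge0.
have brE : (m - r) * (m + r) = m * (1 - D2).
  rewrite -subr_sqr r2.
  suff : n%:R * m = n%:R - D2 by move=> H; ring: H.
  by rewrite mulrC.
have b0 : 0 < m - r.
  have : 0 < (m - r) * (m + r) by rewrite brE mulr_gt0 // subr_gt0.
  by rewrite pmulr_lgt0 //; lra.
have sd : \sum_i (d i - m) = 0.
  by rewrite sumrB s1 sumr_const card_ord -(mulr_natr m) mn subrr.
have sd2 : \sum_i (d i - m) ^+ 2 = n%:R * (m - m ^+ 2).
  under eq_bigr do rewrite sqrrB.
  rewrite big_split sumrB /= sumrMnl -mulr_suml s1 s2 sumr_const card_ord.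
  by rewrite -mn -(mulr_natr (_ * _)) -(mulr_natr (_ ^+ _)); ring.
have dev i : `|d i - m| <= r.
  rewrite -(@ler_pXn2r _ 2) ?nnegrE // real_normK ?num_real // r2.
  have /eqP := sd; rewrite (bigD1 i) //= addr_eq0 => /eqP di.
  have sd2' := sd2; rewrite (bigD1 i) //= in sd2'.
  set q := \sum_(j | _) _ in sd2'.
  have cs : (d i - m) ^+ 2 <= (n%:R - 1) * q.
    rewrite di sqrrN /q.
    apply: le_trans (sqr_sum_le _ _) _.
    by rewrite (cardC1 i) card_ord -subn1 natrB.
  have : n%:R * (d i - m) ^+ 2 <= n%:R * ((n%:R - 1) * (m - m ^+ 2)).
    have -> : n%:R * ((n%:R - 1) * (m - m ^+ 2)) =
       (n%:R - 1) * ((d i - m) ^+ 2 + q) by rewrite sd2'; ring.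
    lra.
  by rewrite ler_pM2l; lra.
have dpos i : 0 < d i.
  have := dev i; rewrite ler_norml => /andP[+ _]; lra.
have p0 : 0 < \prod_i d i by exact: prodr_gt0.
split=> //; rewrite -brE -ler_ln ?posrE ?exprn_gt0 ?mulr_gt0 //; last lra.
rewrite !lnXn ?mulr_gt0 //; last lra.
rewrite lnM ?posrE //; last lra.
rewrite ln_prod //.
have [r_eq0|rn0] := eqVneq r 0.
  rewrite r_eq0 subr0 addr0.
  rewrite (eq_bigr (fun=> ln m)); last first.
    by move=> i _; have := dev i; rewrite r_eq0 normr_le0 subr_eq0 => /eqP->.
  by rewrite sumr_const card_ord mulr2n mulrnDl.
have rgt0 : 0 < r by rewrite lt_def rn0.
have : \sum_i ((m + r - d i) * ln (m - r) + (d i - m + r) * ln (m + r))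
       <= \sum_i (2 * r * ln (d i)).
  by apply: ler_sum => i _; exact: ln_ge_chord.
rewrite -mulr_sumr big_split /= -!mulr_suml.
have -> : \sum_i (m + r - d i) = n%:R * r.
  transitivity (\sum_(i < n) (r - (d i - m))); first by apply: eq_bigr=> i _; ring.
  by rewrite sumrB sd sumr_const card_ord -(mulr_natl r) subr0.
have -> : \sum_i (d i - m + r) = n%:R * r.
  by rewrite big_split /= sd sumr_const card_ord -(mulr_natl r) add0r.
rewrite -(mulr_natl (_ + _) n) -(mulr_natr _ 2) => H; rewrite -(ler_pM2l rgt0).
lra.
Qed.

(** * Positive semidefinite matrices *)

Section Dot.
Variable R : realType.
Implicit Types n : nat.

Lemma dotE n (x y : 'cV[R]_n) : dot x y = (x^T *m y) 0 0.
Proof. by rewrite mxE; apply: eq_bigr => i _; rewrite mxE. Qed.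

Lemma dotC n (x y : 'cV[R]_n) : dot x y = dot y x.
Proof. by apply: eq_bigr => i _; rewrite mulrC. Qed.

Lemma dotDl n (x y z : 'cV[R]_n) : dot (x + y) z = dot x z + dot y z.
Proof. by rewrite !dotE linearD mulmxDl mxE. Qed.

Lemma dotZl n a (x y : 'cV[R]_n) : dot (a *: x) y = a * dot x y.
Proof. by rewrite !dotE linearZ -scalemxAl mxE. Qed.

Lemma dotDr n (x y z : 'cV[R]_n) : dot z (x + y) = dot z x + dot z y.
Proof. by rewrite !(dotC z) dotDl. Qed.

Lemma dotZr n a (x y : 'cV[R]_n) : dot y (a *: x) = a * dot y x.
Proof. by rewrite !(dotC y) dotZl. Qed.

Lemma dotNl n (x y : 'cV[R]_n) : dot (- x) y = - dot x y.
Proof. by rewrite -scaleN1r dotZl mulN1r. Qed.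

Lemma dotNr n (x y : 'cV[R]_n) : dot x (- y) = - dot x y.
Proof. by rewrite !(dotC x) dotNl. Qed.

Lemma dot0l n (x : 'cV[R]_n) : dot 0 x = 0.
Proof. by rewrite -(scale0r 0) dotZl mul0r. Qed.

Lemma dot_mulmxl m n (A : 'M[R]_(m, n)) x y :
  dot (A *m x) y = dot x (A^T *m y).
Proof. by rewrite !dotE trmx_mul mulmxA. Qed.

Lemma dot_ge0 n (x : 'cV[R]_n) : 0 <= dot x x.
Proof. by apply: sumr_ge0 => i _; rewrite -expr2 sqr_ge0. Qed.

Lemma dot_eq0 n (x : 'cV[R]_n) : (dot x x == 0) = (x == 0).
Proof.
apply/idP/eqP => [|->]; last by rewrite dot0l eqxx.
rewrite /dot psumr_eq0 => [/allP x0|i _]; last by rewrite -expr2 sqr_ge0.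
apply/colP => i; rewrite mxE; apply/eqP.
by have := x0 i (mem_index_enum _); rewrite mulf_eq0 orbb.
Qed.

Lemma dot_gt0 n (x : 'cV[R]_n) : x != 0 -> 0 < dot x x.
Proof. by move=> x0; rewrite lt_def dot_eq0 x0 dot_ge0. Qed.

Lemma norm2_sqr n (x : 'cV[R]_n) : norm2 x ^+ 2 = dot x x.
Proof. by rewrite sqr_sqrtr ?dot_ge0. Qed.

Lemma normF_sqr_sum m n (A : 'M[R]_(m, n)) :
  normF A ^+ 2 = \sum_i \sum_j A i j ^+ 2.
Proof.
rewrite sqr_sqrtr //; apply: sumr_ge0 => i _; apply: sumr_ge0 => j _.
exact: sqr_ge0.
Qed.

Lemma normF_sqr n (A : 'M[R]_n) : A^T = A -> normF A ^+ 2 = \tr (A *m A).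
Proof.
move=> AT; rewrite normF_sqr_sum.
apply: eq_bigr => i _; rewrite mxE; apply: eq_bigr => j _.
by rewrite -[in X in _ * X]AT mxE expr2.
Qed.

Lemma sqr_mxtrace_le n (A : 'M[R]_n) : \tr A ^+ 2 <= n%:R * normF A ^+ 2.
Proof.
apply: le_trans (sqr_sum_le _ _) _; rewrite card_ord ler_wpM2l // normF_sqr_sum.
apply: ler_sum => i _; rewrite (bigD1 i) //= lerDl sumr_ge0 // => j _.
exact: sqr_ge0.
Qed.

Lemma mxtrace_outer n (X : 'M[R]_n) (x : 'cV[R]_n) :
  \tr (X *m (x *m x^T)) = dot (X *m x) x.
Proof.
by rewrite mulmxA mxtrace_mulC dotC dotE /mxtrace big_ord1.
Qed.

End Dot.

Definition psd (R : realType) (n : nat) (A : 'M[R]_n) : Prop :=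
  A^T = A /\ forall v : 'cV[R]_n, 0 <= dot (A *m v) v.

Section PSD.
Variable R : realType.
Implicit Types n : nat.

Lemma pd_psd n (A : 'M[R]_n) : positive_definite A -> psd A.
Proof.
move=> [AT Ap]; split=> // v; have [->|/Ap/ltW//] := eqVneq v 0.
by rewrite mulmx0 dot0l.
Qed.

Lemma psd_congr m n (A : 'M[R]_n) (B : 'M[R]_(m, n)) :
  psd A -> psd (B *m A *m B^T).
Proof.
move=> [AT Ap]; split=> [|v]; first by rewrite !trmx_mul trmxK AT mulmxA.
by rewrite -!mulmxA dot_mulmxl.
Qed.

Lemma psd_spectrum n (A : 'M[R]_n) : psd A ->
  exists d : 'I_n -> R,
    [/\ \det A = \prod_i d i, \tr A = \sum_i d i,
        \tr (A *m A) = \sum_i d i ^+ 2 & forall i, 0 <= d i].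
Proof.
move=> [AT Ap]; have [d [dd td t2d ev]] := real_spectrum AT; exists d; split=> // i.
have [v v0 vE] := ev i; have := Ap v.
by rewrite vE dotZl pmulr_lge0 // dot_gt0.
Qed.

Lemma pd_det_gt0 n (A : 'M[R]_n) : positive_definite A -> 0 < \det A.
Proof.
move=> [AT Ap]; have [d [-> _ _ ev]] := real_spectrum AT.
apply: prodr_gt0 => i _; have [v v0 vE] := ev i; have := Ap v v0.
by rewrite vE dotZl pmulr_lgt0 // dot_gt0.
Qed.

Lemma psd_det_le_trace n (A : 'M[R]_n) : psd A ->
  0 <= \tr A /\ \det A <= (\tr A / n%:R) ^+ n.
Proof.
move=> /psd_spectrum[d [-> -> _ d0]].
by split; [exact: sumr_ge0 | exact: prod_le_mean_expn].
Qed.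

Lemma psd_normF_le_trace n (A : 'M[R]_n) : psd A -> normF A ^+ 2 <= \tr A ^+ 2.
Proof.
move=> Ap; have [AT _] := Ap; rewrite normF_sqr //.
have [d [_ -> -> d0]] := psd_spectrum Ap.
by rewrite -subr_ge0 -sum_pairs sumr_ge0 // => p _; rewrite mulr_ge0.
Qed.

Lemma psd_sqr_det_le n (A : 'M[R]_n) : (1 < n)%N -> psd A ->
  \det A ^+ 2 <= ((\tr A ^+ 2 - normF A ^+ 2) / (n%:R * (n%:R - 1))) ^+ n.
Proof.
move=> n1 Ap; have [AT _] := Ap; rewrite normF_sqr //.
by have [d [-> -> -> d0]] := psd_spectrum Ap; exact: sqr_prod_le.
Qed.

Lemma psd_sqr_det_ge n (A : 'M[R]_n) (D2 : R) :
  (0 < n)%N -> psd A -> 0 <= D2 < 1 ->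
  \tr A = n%:R - D2 -> normF A ^+ 2 = n%:R - D2 ->
  ((n%:R - D2) / n%:R * (1 - D2)) ^+ n <= \det A ^+ 2 /\ 0 < \det A.
Proof.
move=> n0 Ap D01 tA; have [AT _] := Ap; rewrite normF_sqr // => nA.
have [d [-> td t2d d0]] := psd_spectrum Ap.
by apply: sqr_prod_ge; rewrite -?td -?t2d.
Qed.

(** Otherwise the nonnegative quadratic form would become negative at v + t w, where
    w = A v and t is a small negative number: the term linear in t is
    2 t <w, w>. *)
Lemma psd_ker n (A : 'M[R]_n) (v : 'cV[R]_n) : psd A ->
  dot (A *m v) v = 0 -> A *m v = 0.
Proof.
move=> [AT Ap] v0; apply/eqP; rewrite -dot_eq0; apply/negPn/negP => nz.
set w := A *m v in v0 nz *; set a := dot w w in nz.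
have a0 : 0 < a by rewrite lt_def nz dot_ge0.
have q t : 0 <= 2 * t * a + t ^+ 2 * dot (A *m w) w.
  have := Ap (v + t *: w); rewrite mulmxDr -scalemxAr !(dotDl, dotDr, dotZl, dotZr).
  rewrite -/w v0 (dot_mulmxl A w v) AT -/w -/a.
  by move=> H; apply: le_trans H _; rewrite le_eqVlt; apply/orP; left; apply/eqP; ring.
set c := dot (A *m w) w in q.
have c0 : 0 <= c by exact: Ap.
(* The minimum is at t = - a / c; c + 1 avoids the case c = 0. *)
have := q (- a / (c + 1)).
have c1 : 0 < c + 1 by rewrite ltr_wpDl.
have -> : 2 * (- a / (c + 1)) * a + (- a / (c + 1)) ^+ 2 * c =
  (- a ^+ 2 * (c + 2)) / (c + 1) ^+ 2 by field; rewrite gt_eqF.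
rewrite ler_pdivlMr ?exprn_gt0 // mul0r mulNr oppr_ge0 leNgt mulr_gt0 ?exprn_gt0 //.
by rewrite ltr_wpDl.
Qed.

Lemma psd_det_pd n (A : 'M[R]_n) : psd A -> \det A != 0 -> positive_definite A.
Proof.
move=> Ap dA; split; [by case: Ap | move=> v v0].
have [_ /(_ v)] := Ap; rewrite le_eqVlt => /orP[/eqP/esym/(psd_ker Ap) Av|//].
have Au : A \in unitmx by rewrite unitmxE unitfE.
by move: v0; rewrite -(mulKmx Au v) Av mulmx0 eqxx.
Qed.

Lemma pd_unit n (A : 'M[R]_n) : positive_definite A -> A \in unitmx.
Proof. by move=> /pd_det_gt0 dA; rewrite unitmxE unitfE gt_eqF. Qed.

Lemma pd_inv n (A : 'M[R]_n) : positive_definite A -> positive_definite (invmx A).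
Proof.
move=> Ap; have Au := pd_unit Ap; have [AT App] := Ap.
split=> [|v v0]; first by rewrite trmx_inv AT.
rewrite -{2}(mulKVmx Au v) dotC App //.
apply: contra v0 => /eqP iv0; by rewrite -(mulKVmx Au v) iv0 mulmx0.
Qed.

(** Completing the square in the first coordinate leaves the quadratic form of the
    Schur complement S in the other ones, so the first row of the factor is
    sqrt (X 0 0)^-1 times that of X and the rest is a factor of S. The triangular
    shape is what makes the volume computable coordinate by coordinate. *)
Lemma cholesky n (X : 'M[R]_n) : positive_definite X ->
  exists A : 'M[R]_n, [/\ X = A^T *m A, is_trig_mx A^T & forall i, 0 < A i i].
Proof.
elim: n X => [|n IH] X [XT Xp].
  exists 1%:M; split=> [||[]//]; first by apply/matrixP => -[].
  by apply/is_trig_mxP => -[].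
pose x := X 0 0; pose r : 'rV[R]_n := ursubmx (X : 'M[R]_(1 + n)).
pose X' : 'M[R]_n := drsubmx (X : 'M[R]_(1 + n)).
have XE : X = block_mx (x%:M : 'M[R]_1) r r^T X' :> 'M[R]_(1 + n).
  rewrite -[LHS](@submxK _ 1 n 1 n); congr block_mx.
    by rewrite [LHS]mx11_scalar; congr (_%:M); rewrite !mxE;
      congr (X _ _); exact/val_inj.
  by rewrite /r -[in RHS]XT; apply/matrixP => i j; rewrite !mxE.
have X'T : X'^T = X' by rewrite /X' -[in RHS]XT; apply/matrixP => i j; rewrite !mxE.
have x0 : 0 < x.
  have : (delta_mx 0 0 : 'cV[R]_n.+1) != 0.
    by apply/eqP => /colP/(_ 0)/eqP; rewrite !mxE !eqxx oner_eq0.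
  by move/Xp; rewrite dotC dotE -colE trmx_delta -rowE !mxE.
pose S := X' - x^-1 *: (r^T *m r).
have Spd : positive_definite S.
  split; first by rewrite /S linearB linearZ /= trmx_mul trmxK X'T.
  move=> v v0; pose w : 'cV[R]_(1 + n) := col_mx (- x^-1 *: (r *m v)) v.
  have w0 : w != 0 by apply: contra v0 => /eqP; rewrite -col_mx0 => /eq_col_mx[_ ->].
  have Xw : 0 < dot (block_mx (x%:M : 'M[R]_1) r r^T X' *m w) w.
    by rewrite -[X in X *m _]XE; exact: Xp.
  move: Xw; rewrite mul_block_col mul_scalar_mx scalerA mulrN divff ?gt_eqF //.
  rewrite scaleN1r addNr dotC dotE tr_col_mx mul_row_col mulmx0 add0r.
  rewrite dotC dotE mulmxBl -scalemxAl -scalemxAr scaleNr addrC.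
  by rewrite !mulmxA.
have [A [SE Atrig Apos]] := IH S Spd.
pose s := Num.sqrt x; have s0 : 0 < s by rewrite sqrtr_gt0.
have s2 : s * s = x by rewrite -expr2 sqr_sqrtr // ltW.
pose B : 'M[R]_(1 + n) := block_mx (s%:M : 'M[R]_1) (s^-1 *: r) 0 A.
have XB : block_mx (x%:M : 'M[R]_1) r r^T X' = B^T *m B.
  rewrite /B tr_block_mx mulmx_block trmx0 !mul0mx !addr0 -SE.
  rewrite tr_scalar_mx -scalar_mxM s2 mul_scalar_mx scalerA divff ?gt_eqF // scale1r.
  rewrite mul_mx_scalar linearZ /= scalerA divff ?gt_eqF // scale1r.
  rewrite -scalemxAl -scalemxAr scalerA -invfM s2 /S.
  by congr block_mx; [rewrite mulmx0 addr0 | rewrite [RHS]addrC subrK].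
have Btrig : is_trig_mx B^T.
  by rewrite /B tr_block_mx trmx0 is_trig_block_mx // Atrig tr_scalar_mx
    scalar_mx_is_trig eqxx.
have Bpos (i : 'I_(1 + n)) : 0 < B i i.
  rewrite -(fintype.splitK i); case: (fintype.split i) => j /=.
    by rewrite block_mxEul ord1 mxE eqxx.
  by rewrite block_mxEdr.
by exists B; split=> //; exact: etrans XE XB.
Qed.

Lemma det_upper_trig_gt0 n (A : 'M[R]_n) : is_trig_mx A^T -> (forall i, 0 < A i i) ->
  0 < \det A.
Proof.
move=> At Ap; rewrite -det_tr det_trig //; apply: prodr_gt0 => i _.
by rewrite mxE.
Qed.

(** With X = A^T A, the inequality of means applies to the eigenvalues of the
    positive semidefinite matrix A Y A^T, which has the trace and the determinant
    of X Y. *)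
Lemma pd_trace_det_le1 n (X Y : 'M[R]_n) : (0 < n)%N ->
  positive_definite X -> psd Y -> \tr (X *m Y) <= n%:R -> \det X * \det Y <= 1.
Proof.
move=> n0 /cholesky[A [-> _ _]] Yp.
have Zp := psd_congr A Yp.
rewrite -mulmxA mxtrace_mulC => trZ.
have -> : \det (A^T *m A) * \det Y = \det (A *m Y *m A^T).
  by rewrite !det_mulmx; ring.
have [t0 le] := psd_det_le_trace Zp; apply: le_trans le _.
apply: exprn_ile1; first by rewrite divr_ge0.
by rewrite ler_pdivrMr ?ltr0n // mul1r.
Qed.

(** The matrix determinant lemma: 1 + u v^T and the scalar 1 + v^T u are the two
    Schur complements of one block matrix. *)
Lemma det_1_add_outer n (u v : 'cV[R]_n) : \det (1%:M + u *m v^T) = 1 + dot v u.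
Proof.
pose P : 'M[R]_(n + 1) := block_mx 1%:M 0 v^T 1%:M.
pose Q : 'M[R]_(n + 1) := block_mx (1%:M + u *m v^T) u 0 1%:M.
pose S : 'M[R]_(n + 1) := block_mx 1%:M 0 (- v^T) 1%:M.
have E : P *m Q *m S = block_mx 1%:M u 0 (1%:M + v^T *m u).
  rewrite /P /Q /S !mulmx_block !(mul1mx, mul0mx, mulmx0, mulmx1, addr0, add0r).
  rewrite !mulmxN addrK mulmxDr mulmx1 mulmxDl mul1mx opprD.
  by congr block_mx; [rewrite mulmxA -opprD [X in _ - X]addrC subrr | rewrite addrC].
have := congr1 determinant E; rewrite !det_mulmx /P /Q /S.
rewrite !det_lblock !det_ublock !det1 !mul1r !mulr1 => ->.
by rewrite [X in \det X]mx11_scalar det_scalar1 !mxE eqxx /= dotE mxE.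
Qed.

Lemma det_add_outer n (Y : 'M[R]_n) (u : 'cV[R]_n) (a t : R) : Y \in unitmx ->
  a != 0 ->
  \det (a *: Y + t *: (u *m u^T))
    = a ^+ n * \det Y * (1 + t / a * dot (invmx Y *m u) u).
Proof.
move=> Yu a0.
have -> : a *: Y + t *: (u *m u^T) =
   (a *: Y) *m (1%:M + (t / a) *: ((invmx Y *m u) *m u^T)).
  rewrite mulmxDr mulmx1 -scalemxAl -scalemxAr !mulmxA mulmxV // mul1mx scalerA.
  by rewrite mulrCA divff // mulr1.
rewrite det_mulmx detZ scalemxAl det_1_add_outer dotC.
by rewrite dotZl.
Qed.
End PSD.

(** * Frame operators and the distance to the identity *)

Section Continuity.
Variables (R : realType) (T : topologicalType).

Lemma continuous_sum (I : Type) (s : seq I) (P : pred I) (F : I -> T -> R) :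
  (forall i, continuous (F i)) -> continuous (fun x => \sum_(i <- s | P i) F i x).
Proof.
move=> Fc; elim: s => [|i s IH].
  under [X in continuous X]eq_fun do rewrite big_nil.
  by move=> x; exact: cvg_cst.
under [X in continuous X]eq_fun do rewrite big_cons.
by case: (P i) => // x; apply: continuousD; [exact: Fc | exact: IH].
Qed.

Lemma continuous_prod (I : Type) (s : seq I) (P : pred I) (F : I -> T -> R) :
  (forall i, continuous (F i)) -> continuous (fun x => \prod_(i <- s | P i) F i x).
Proof.
move=> Fc; elim: s => [|i s IH].
  under [X in continuous X]eq_fun do rewrite big_nil.
  by move=> x; exact: cvg_cst.
under [X in continuous X]eq_fun do rewrite big_cons.
by case: (P i) => // x; apply: continuousM; [exact: Fc | exact: IH].
Qed.

Lemma continuous_mulf (f g : T -> R) :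
  continuous f -> continuous g -> continuous (fun x => f x * g x).
Proof. by move=> fc gc x; apply: continuousM; [exact: fc | exact: gc]. Qed.

Lemma continuous_det n (A : T -> 'M[R]_n) :
  (forall i j, continuous (fun x => A x i j)) -> continuous (fun x => \det (A x)).
Proof.
move=> Ac; apply: continuous_sum => s; apply: continuous_mulf.
  exact: cst_continuous.
by apply: continuous_prod => i; exact: Ac.
Qed.
End Continuity.

Section Frame.
Variables (R : realType) (N M : nat) (Phi : 'I_M -> 'cV[R]_N).
Implicit Type c : 'I_M -> R.

Definition frame_op c : 'M[R]_N := \sum_i c i *: (Phi i *m (Phi i)^T).

Lemma frame_opZ a c : a *: frame_op c = frame_op (fun i => a * c i).
Proof. by rewrite scaler_sumr; apply: eq_bigr => i _; rewrite scalerA. Qed.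

Lemma frame_op_sym c : (frame_op c)^T = frame_op c.
Proof.
rewrite linear_sum; apply: eq_bigr => i _.
by rewrite linearZ /= trmx_mul trmxK.
Qed.

Lemma mxtrace_frame_op (X : 'M[R]_N) c :
  \tr (X *m frame_op c) = \sum_i c i * dot (X *m Phi i) (Phi i).
Proof.
rewrite mulmx_sumr linear_sum; apply: eq_bigr => i _.
by rewrite -scalemxAr linearZ /= mxtrace_outer.
Qed.

Lemma frame_op_quad c (v : 'cV[R]_N) :
  dot (frame_op c *m v) v = \sum_i c i * dot v (Phi i) ^+ 2.
Proof.
rewrite -mxtrace_outer mxtrace_mulC mxtrace_frame_op; apply: eq_bigr => i _.
congr (_ * _); rewrite -mulmxA [X in v *m X]mx11_scalar -dotE mul_mx_scalar.
by rewrite dotZl expr2.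
Qed.

Lemma frame_op_psd c : (forall i, 0 <= c i) -> psd (frame_op c).
Proof.
move=> c0; split=> [|v]; first exact: frame_op_sym.
by rewrite frame_op_quad sumr_ge0 // => i _; rewrite mulr_ge0 ?sqr_ge0.
Qed.

Lemma continuous_frame_op i j :
  continuous (fun c : 'rV[R]_M => frame_op (c 0) i j).
Proof.
under [X in continuous X]eq_fun do rewrite /frame_op summxE.
apply: continuous_sum => k.
under [X in continuous X]eq_fun do rewrite mxE.
move=> x; apply: continuousM; last exact: cst_continuous.
exact: coord_continuous.
Qed.

Hypothesis PhiU : unit_norm Phi.

Lemma unit_dot i : dot (Phi i) (Phi i) = 1.
Proof. by rewrite -norm2_sqr PhiU expr1n. Qed.

Lemma mxtrace_frame_op1 c : \tr (frame_op c) = \sum_i c i.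
Proof.
rewrite -[frame_op c]mul1mx mxtrace_frame_op; apply: eq_bigr => i _.
by rewrite mul1mx unit_dot mulr1.
Qed.

Lemma compact_box (b : R) :
  compact [set c : 'rV[R]_M | forall i, 0 <= c 0 i <= b].
Proof.
have := @rV_compact R M (fun=> `[0, b]%classic) (fun=> @segment_compact R _ _).
by congr compact; apply/seteqP; split=> c /= h i; have := h i; rewrite in_itv.
Qed.

Lemma normF_frame_op c :
  normF (frame_op c - 1%:M) ^+ 2
    = normF (frame_op c) ^+ 2 - 2 * \sum_i c i + N%:R.
Proof.
have ST : (frame_op c - 1%:M)^T = frame_op c - 1%:M.
  by rewrite linearB /= frame_op_sym trmx1.
rewrite !normF_sqr ?frame_op_sym // mulmxBl !mulmxBr !mulmx1 mul1mx.
rewrite !linearB /= mxtrace_frame_op1 mxtrace1; ring.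
Qed.

Lemma sum_le_normF c :
  (\sum_i c i - N%:R) ^+ 2 <= N%:R * normF (frame_op c - 1%:M) ^+ 2.
Proof.
have := sqr_mxtrace_le (frame_op c - 1%:M).
by rewrite linearB /= mxtrace_frame_op1 mxtrace1.
Qed.

(** The cone of weights is not compact, but the distance at c = 0 is sqrt N, and
    it is exceeded as soon as one weight exceeds 2 N: by Cauchy-Schwarz on the
    diagonal, (sum c - N)^2 is at most N times the squared distance. Hence a
    minimum over the box [0, 2 N]^M is a minimum over the cone. *)
Lemma frameD_attained : exists2 c, forall i, 0 <= c i &
  frameD Phi = normF (frame_op c - 1%:M) /\
  forall c', (forall i, 0 <= c' i) -> frameD Phi <= normF (frame_op c' - 1%:M).
Proof.
pose f (c : 'rV[R]_M) := normF (frame_op (c 0) - 1%:M) ^+ 2.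
have fc : continuous f.
  rewrite /f; under [X in continuous X]eq_fun do rewrite normF_sqr_sum.
  apply: continuous_sum => i; apply: continuous_sum => j.
  have Aij : continuous (fun c : 'rV[R]_M => (frame_op (c 0) - 1%:M) i j).
    have -> : (fun c : 'rV[R]_M => (frame_op (c 0) - 1%:M) i j)
      = (fun c : 'rV[R]_M => frame_op (c 0) i j) \- cst (1%:M i j).
      by apply/funext => c; rewrite !mxE.
    move=> x; apply: continuousB; first exact: continuous_frame_op.
    exact: cst_continuous.
  exact: continuous_mulf.
have [|c /[!inE]/= cB cmin] :=
    compact_EVT_min (f := f) _ (@compact_box (2 * N%:R)) (continuous_subspaceT fc).
  by exists 0 => i /=; rewrite mxE lexx mulr_ge0.
have f0 : f 0 = N%:R.
  rewrite /f (_ : frame_op _ = 0).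
    rewrite sub0r normF_sqr; last by rewrite linearN /= trmx1.
    by rewrite mulNmx mul1mx opprK mxtrace1.
  by rewrite /frame_op big1 // => i _; rewrite mxE scale0r.
have best c' : (forall i, 0 <= c' i) -> f c <= normF (frame_op c' - 1%:M) ^+ 2.
  move=> c'0.
  have fE : frame_op c' = frame_op ((\row_i c' i) 0).
    by apply: eq_bigr => i _; rewrite mxE.
  have [c'b|/existsNP[i /negP]] := pselect (forall i, c' i <= 2 * N%:R).
    rewrite fE; apply: (cmin (\row_i c' i)).
    by rewrite inE /= => i; rewrite mxE c'0 c'b.
  rewrite -ltNge => ci; apply: (@le_trans _ _ N%:R).
    by rewrite -f0; apply: cmin; rewrite inE /= => j; rewrite mxE lexx mulr_ge0.
  have si : c' i <= \sum_i c' i.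
    by rewrite (bigD1 i) //= lerDl sumr_ge0 // => j _.
  have := sum_le_normF c'; set s := \sum_i c' i in si *; move=> sN.
  have [N0|N0] := posnP N; first by rewrite {1}N0 sqr_ge0.
  have N0R : 0 < N%:R :> R by rewrite ltr0n.
  rewrite -(ler_pM2l N0R); apply: le_trans sN.
  by rewrite -expr2 ler_sqr ?nnegrE //; lra.
exists (c 0) => [i|]; first by case/andP: (cB i).
have nge0 (A : 'M[R]_N) : 0 <= normF A by exact: sqrtr_ge0.
have mem : frameD Phi = normF (frame_op (c 0) - 1%:M).
  rewrite /frameD /minimum; set S := (X in X `&` _).
  have : (S `&` lbound S) (normF (frame_op (c 0) - 1%:M)).
    split; first by exists (c 0) => // i /=; case/andP: (cB i).
    move=> _ [c' c'0 <-]; rewrite -/(frame_op c').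
    by rewrite -(@ler_pXn2r _ 2) ?nnegrE //; exact: best.
  move=> h; have [h1 h2] := xgetPex 0 (ex_intro _ _ h).
  apply/eqP; rewrite eq_le; apply/andP; split; first by apply: h2; case: h.
  by case: h => _; apply; exact: h1.
split=> // c' c'0; rewrite mem -(@ler_pXn2r _ 2) ?nnegrE //; exact: best.
Qed.

End Frame.

(** * Frame operators of maximal determinant *)

Section OptimalDesign.
Variables (R : realType) (N M : nat) (Phi : 'I_M -> 'cV[R]_N).
Hypotheses (N0 : (0 < N)%N) (PhiF : is_frame Phi).

Let N0R : 0 < N%:R :> R. Proof. by rewrite ltr0n. Qed.

Lemma frame_card_gt0 : (0 < M)%N.
Proof.
have [A [B [A0 _ AB]]] := PhiF.
have [M0|//] := posnP M; pose v : 'cV[R]_N := const_mx 1.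
have v0 : v != 0.
  by apply/eqP => /colP/(_ (Ordinal N0))/eqP; rewrite !mxE oner_eq0.
have /andP[+ _] := AB v; rewrite norm2_sqr big1 => [|i _].
  by rewrite leNgt mulr_gt0 // dot_gt0.
by have := leq_ltn_trans (leq0n i) (ltn_ord i); rewrite [X in (0 < X)%N]M0.
Qed.

Lemma frame_op_pd (a : R) : 0 < a -> positive_definite (frame_op Phi (fun=> a)).
Proof.
move=> a0; split=> [|v v0]; first exact: frame_op_sym.
have [A [B [A0 _ /(_ v)/andP[AB _]]]] := PhiF.
rewrite frame_op_quad -mulr_sumr mulr_gt0 //.
under eq_bigr do rewrite -real_normK ?num_real //.
by apply: lt_le_trans AB; rewrite mulr_gt0 // norm2_sqr dot_gt0.
Qed.

(** The frame condition makes the determinant positive at the uniform weights, hence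
    at the maximum. *)
Lemma max_det_attained : exists c : 'I_M -> R,
  [/\ forall i, 0 <= c i, \sum_i c i = N%:R,
      positive_definite (frame_op Phi c) &
      forall c' : 'I_M -> R, (forall i, 0 <= c' i) -> \sum_i c' i = N%:R ->
        \det (frame_op Phi c') <= \det (frame_op Phi c)].
Proof.
have M0 := frame_card_gt0; have M0R : 0 < M%:R :> R by rewrite ltr0n.
pose simplex : set 'rV[R]_M :=
  [set c | forall i, 0 <= c 0 i <= N%:R] `&` [set c | \sum_i c 0 i = N%:R].
pose f (c : 'rV[R]_M) := \det (frame_op Phi (c 0)).
have fc : continuous f.
  by apply: continuous_det => i j; exact: continuous_frame_op.
have simplexP (c : 'I_M -> R) : (forall i, 0 <= c i) -> \sum_i c i = N%:R ->
    (\row_i c i) \in simplex /\ f (\row_i c i) = \det (frame_op Phi c).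
  move=> c0 cN; split.
    rewrite inE; split=> /= [i|]; last first.
      by rewrite -cN; apply: eq_bigr => i _; rewrite mxE.
    by rewrite mxE c0 -cN (bigD1 i) //= lerDl sumr_ge0.
  by congr (\det _); apply: eq_bigr => i _; rewrite mxE.
have u0 (i : 'I_M) : 0 <= N%:R / M%:R :> R by rewrite divr_ge0.
have uN : \sum_(i < M) N%:R / M%:R = N%:R :> R.
  by rewrite sumr_const card_ord -[LHS]mulr_natr divfK // gt_eqF.
have [uS uE] := simplexP (fun=> N%:R / M%:R) u0 uN.
have simplexC : compact simplex.
  apply: subclosed_compact (@compact_box _ _ N%:R) _; last by move=> c [].
  apply: closedI.
    exact: compact_closed (@compact_box _ _ _).
  apply: (@preimage_closed _ _ (fun c : 'rV[R]_M => \sum_i c 0 i) [set N%:R]).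
    by move=> x _; apply: continuous_sum => i y; exact: coord_continuous.
  exact: closed_eq.
have [|c cS cmax] := compact_EVT_max (f := f) _ simplexC (continuous_subspaceT fc).
  by exists (\row_i (N%:R / M%:R)); rewrite -inE.
move: (cS); rewrite inE => -[cB cN].
have c0 i : 0 <= c 0 i by case/andP: (cB i).
exists (c 0); split=> //.
  apply: psd_det_pd; first exact: frame_op_psd.
  rewrite gt_eqF //; apply: lt_le_trans (cmax _ uS); rewrite uE.
  by apply/pd_det_gt0/frame_op_pd; rewrite divr_gt0.
by move=> c' c'0 c'N; have [c'S <-] := simplexP c' c'0 c'N; exact: cmax.
Qed.

(** The optimality condition of Kiefer and Wolfowitz. With q = <Y^-1 phi_i, phi_i>,
    the determinant lemma gives
      det ((1 - e) Y + e N phi_i phi_i^T)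
        = det Y (1 - e)^(N - 1) (1 - e + e N q),
    whose derivative at e = 0 is N (q - 1) det Y. To stay algebraic, the proof
    exhibits for q > 1 one step e at which the determinant exceeds det Y. *)
Lemma max_det_leverage (c : 'I_M -> R) : unit_norm Phi ->
  (forall i, 0 <= c i) -> \sum_i c i = N%:R ->
  positive_definite (frame_op Phi c) ->
  (forall c' : 'I_M -> R, (forall i, 0 <= c' i) -> \sum_i c' i = N%:R ->
        \det (frame_op Phi c') <= \det (frame_op Phi c)) ->
  forall i, dot (invmx (frame_op Phi c) *m Phi i) (Phi i) <= 1.
Proof.
move=> PhiU c0 cN Yp cmax i; set Y := frame_op Phi c in Yp cmax *.
set q := dot _ _; rewrite leNgt; apply/negP => q1.
have q0 : 0 < q by exact: lt_trans q1.
(* By Bernoulli's inequality and e N q = q - 1, the relative gain at this step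
   is at least e (q - 1) + (N - 1) e^2. *)
pose e := (q - 1) / (N%:R * q).
have Nq : 0 < N%:R * q by rewrite mulr_gt0.
have N1 : 1 <= N%:R :> R by rewrite ler1n.
have e0 : 0 < e by rewrite divr_gt0 // subr_gt0.
have e1 : e < 1.
  rewrite ltr_pdivrMr // mul1r; apply: lt_le_trans (_ : q <= _); first lra.
  by rewrite ler_peMl // ltW.
have eE : e * (N%:R * q) = q - 1 by rewrite divfK // gt_eqF.
clearbody e.
pose c' j := (1 - e) * c j + (e * N%:R) * (j == i)%:R.
have c'0 j : 0 <= c' j.
  by rewrite addr_ge0 // mulr_ge0 ?ler0n ?subr_ge0 ?(ltW e1) //
    mulr_ge0 ?(ltW e0) ?ler0n.
have c'N : \sum_j c' j = N%:R.
  rewrite big_split /= -!mulr_sumr cN (bigD1 i) //= eqxx big1 => [|j /negPf->//].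
  by rewrite /= addr0 mulr1; ring.
have := cmax c' c'0 c'N.
have -> : frame_op Phi c' = (1 - e) *: Y + (e * N%:R) *: (Phi i *m (Phi i)^T).
  rewrite frame_opZ /frame_op (bigD1 i) //= [in RHS](bigD1 i) //=.
  rewrite -addrA [X in _ = _ + X]addrC addrA.
  rewrite -scalerDl /c' eqxx mulr1; congr (_ + _).
  by apply: eq_bigr => j /negPf->; rewrite mulr0 addr0.
have ne : 1 - e != 0 by rewrite subr_eq0 gt_eqF.
have Ye : 0 < 1 - e by rewrite subr_gt0.
rewrite det_add_outer ?pd_unit // -/q mulrAC -[X in _ <= X]mul1r ler_pM2r ?pd_det_gt0 //.
rewrite leNgt => /negP; apply.
have bern : 1 - N.-1%:R * e <= (1 - e) ^+ N.-1.
  elim: (N.-1) => [|k IH]; first by rewrite mul0r subr0 expr0.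
  rewrite exprS; apply: le_trans (_ : (1 - e) * (1 - k%:R * e) <= _); last first.
    by rewrite ler_wpM2l // ltW.
  rewrite -[k.+1%:R]natr1 -subr_ge0.
  have -> : (1 - e) * (1 - k%:R * e) - (1 - (k%:R + 1) * e) = k%:R * (e * e) by ring.
  by rewrite mulr_ge0 // mulr_ge0 // ltW.
have NE : N%:R = N.-1%:R + 1 :> R by rewrite natr1 prednK.
have -> : (1 - e) ^+ N * (1 + e * N%:R / (1 - e) * q)
    = (1 - e) ^+ N.-1 * (1 - e + e * (N%:R * q)).
  by rewrite -{1}(prednK N0) exprSr; field.
rewrite eE; apply: lt_le_trans (_ : (1 - N.-1%:R * e) * (1 - e + (q - 1)) <= _).
  have -> : (1 - N.-1%:R * e) * (1 - e + (q - 1))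
     = 1 + (e * (q - 1) + N.-1%:R * e ^+ 2) + (q - 1 - e * ((N.-1%:R + 1) * q)).
    by ring.
  rewrite -NE eE subrr addr0 ltrDl ltr_pwDl ?mulr_ge0 ?exprn_ge0 ?(ltW e0) //.
  by rewrite mulr_gt0 // subr_gt0.
by rewrite ler_wpM2r //; lra.
Qed.
End OptimalDesign.

(** * Volume under triangular affine maps *)

(** A pushforward is a measure only along a measurable map; the proof of measurability
    is kept as an argument so that the structure can be inferred from it. *)
Definition image_measure (R : realType) d1 d2 (T1 : measurableType d1)
    (T2 : measurableType d2) (m : {measure set T1 -> \bar R}) (f : T1 -> T2)
    (mf : measurable_fun setT f) : {measure set T2 -> \bar R} :=
  measure_function_pushforward__canonical__measure_function_Measure m mf.

Section ShearMeasure.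
Variable R : realType.

Lemma lebesgue_measure_affine (a b : R) (A : set (measurableTypeR R)) : 0 < a ->
  measurable A ->
  (lebesgue_measure ((fun x : R => a * x + b)%R @^-1` A)
     = a^-1%:E * lebesgue_measure A)%E.
Proof.
move=> a0 mA; pose f : measurableTypeR R -> measurableTypeR R := fun x => a * x + b.
have mf : measurable_fun setT f.
  by apply: measurable_funD => //; exact: measurable_funM.
pose m' : {measure set (measurableTypeR R) -> \bar R} :=
  mscale (NngNum (ltW a0)) (image_measure (@lebesgue_measure R) mf).
have m'E B : m' B = (a%:E * lebesgue_measure (f @^-1` B))%E by [].
have E : lebesgue_measure A = m' A.
  apply: lebesgue_measure_unique => // X [[x y] _ <-].
  rewrite m'E /=.
  rewrite (_ : f @^-1` _ = `](x - b) / a, (y - b) / a]%classic); last first.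
    apply/seteqP; split=> z /=; rewrite !in_itv /= ltr_pdivrMr // ler_pdivlMr //;
      by rewrite /f ltrBlDr lerBrDr mulrC.
  rewrite !lebesgue_measure_itv /= !lte_fin ltr_pM2r ?invr_gt0 // ltrD2r.
  case: ifP => _; last by rewrite mule0.
  by rewrite -!EFinD -EFinM; congr EFin; field; rewrite gt_eqF.
by rewrite E m'E muleA -EFinM mulVf ?gt_eqF // mul1e.
Qed.

Context d (S : measurableType d) (m : {sigma_finite_measure set S -> \bar R}).
Let mu := (@lebesgue_measure R \x m)%E.

(** If g divides the measure m by k, then (x, z) |-> (a x + l z, g z) divides the
    product measure by a k. A product measure is determined by its values on
    rectangles A * B, and the section at z of the preimage of a rectangle is
    either empty or the preimage of A under the affine map x |-> a x + l z,
    whose measure does not depend on z. *)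
Lemma shear_measure (a k : R) (l : S -> measurableTypeR R) (g : S -> S) :
  0 < a -> 0 < k -> measurable_fun setT l -> measurable_fun setT g ->
  (forall B, measurable B -> m (g @^-1` B) = (k^-1%:E * m B)%E) ->
  forall X, measurable X ->
  mu ((fun p : measurableTypeR R * S => (a * p.1 + l p.2, g p.2)) @^-1` X)
   = ((a * k)^-1%:E * mu X)%E.
Proof.
move=> a0 k0 ml mg gk X mX.
pose F : measurableTypeR R * S -> measurableTypeR R * S :=
  fun p => (a * p.1 + l p.2, g p.2).
have mF : measurable_fun setT F.
  apply: measurable_fun_pair; last exact: measurableT_comp.
  apply: measurable_funD; last exact: measurableT_comp.
  by apply: measurable_funM => //; exact: measurable_fst.
have ak0 : 0 < a * k by rewrite mulr_gt0.
pose m' : {measure set (measurableTypeR R * S) -> \bar R} :=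
  mscale (NngNum (ltW ak0)) (image_measure mu mF).
have m'E B : m' B = ((a * k)%:E * mu (F @^-1` B))%E by [].
have E : mu X = m' X.
  apply: product_measure_unique => // A B mA mB.
  rewrite m'E.
  have mFAB : measurable (F @^-1` (A `*` B)).
    by have := mF measurableT _ (measurableX mA mB); rewrite setTI.
  have mgB : measurable (g @^-1` B) by have := mg measurableT _ mB; rewrite setTI.
  have -> : mu (F @^-1` (A `*` B)) =
     (\int[m]_z lebesgue_measure (ysection (F @^-1` (A `*` B)) z))%E.
    apply: (@product_measure_unique _ _ _ _ _ _ m
      (@lebesgue_measure R \x^ m)%E) => // *.
    exact: product_measure2E.
  rewrite (eq_integral (fun z =>
    (a^-1%:E * lebesgue_measure A) * (\1_(g @^-1` B) z)%:E)%E).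
    rewrite ge0_integralZl //=; last 2 first.
    - exact: measurableT_comp.
    - by rewrite mule_ge0 // lee_fin invr_ge0 ltW.
    have -> : (\int[m]_z (\1_(g @^-1` B) z)%:E = k^-1%:E * m B)%E.
      by rewrite integral_indic // setIT; exact: gk.
    rewrite muleACA !muleA -!EFinM (_ : _ / k = 1) ?mul1e //.
    by field; rewrite !gt_eqF.
  move=> z _ /=; rewrite indicE.
  have [zB|zB] := boolP (z \in g @^-1` B).
    rewrite mule1 -(lebesgue_measure_affine (l z)) //; congr lebesgue_measure.
    apply/seteqP; split=> x; rewrite /ysection /= !inE //=.
      by case.
    move=> xA; split=> //=; by rewrite inE in zB.
  rewrite mule0 (_ : ysection _ _ = set0) ?measure0 //.
  apply/seteqP; split=> // x; rewrite /ysection /= !inE /= => -[_ /= gz].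
  by move/negP: zB; rewrite inE.
by rewrite E m'E muleA -EFinM mulVf ?gt_eqF // mul1e.
Qed.
End ShearMeasure.

Section Volume.
Variable R : realType.

(** The inverse of [lebesgue_point]: it turns the images that define volumes into
    preimages, to which measurability applies. *)
Fixpoint lebesgue_vec (n : nat) : sfs_type (lebesgue_space R n) -> 'cV[R]_n :=
  if n is k.+1 return sfs_type (lebesgue_space R n) -> 'cV[R]_n then
    fun s => \col_i oapp (fun j => lebesgue_vec s.2 j 0) s.1 (unlift ord0 i)
  else fun=> 0.

Lemma lebesgue_vec0 n (s : sfs_type (lebesgue_space R n.+1)) :
  lebesgue_vec s 0 0 = s.1.
Proof. by rewrite mxE unlift_none. Qed.

Lemma lebesgue_vecS n (s : sfs_type (lebesgue_space R n.+1)) (j : 'I_n) :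
  lebesgue_vec s (lift ord0 j) 0 = lebesgue_vec s.2 j 0.
Proof. by rewrite mxE liftK. Qed.

Lemma lebesgue_vecK n : cancel (@lebesgue_vec n) (@lebesgue_point R n).
Proof.
elim: n => [|n IH] /=; first by case.
move=> [x z]; congr pair; first by rewrite mxE unlift_none.
rewrite -[RHS]IH; congr lebesgue_point; apply/colP => i.
by rewrite !mxE liftK.
Qed.

Lemma lebesgue_pointK n : cancel (@lebesgue_point R n) (@lebesgue_vec n).
Proof.
elim: n => [|n IH] /= v; first by apply/colP => -[].
apply/colP => i; rewrite mxE; case: unliftP => [j ->|->] //=.
by rewrite IH mxE.
Qed.

Lemma volE n (A : set 'cV[R]_n) :
  vol A = sfs_measure (lebesgue_space R n) (@lebesgue_vec n @^-1` A).
Proof.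
rewrite /vol; congr (sfs_measure _ _); apply/seteqP; split=> [_ [v Av <-]|s As] /=.
  by rewrite lebesgue_pointK.
by exists (lebesgue_vec s) => //; exact: lebesgue_vecK.
Qed.

Lemma measurable_lebesgue_vec n (i : 'I_n) :
  measurable_fun setT
    (fun s : sfs_type (lebesgue_space R n) => lebesgue_vec s i 0 : measurableTypeR R).
Proof.
elim: n i => [[]//|n IH] i.
case: (unliftP ord0 i) => [j ->|->].
  under eq_fun do rewrite lebesgue_vecS.
  exact: (measurableT_comp (IH j) measurable_snd).
under eq_fun do rewrite lebesgue_vec0.
exact: measurable_fst.
Qed.

Lemma measurable_lebesgue_point d (T : measurableType d) n (f : T -> 'cV[R]_n) :
  (forall i, measurable_fun setT (fun t => f t i 0 : measurableTypeR R)) ->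
  measurable_fun setT (fun t => lebesgue_point (f t)).
Proof.
elim: n f => [|n IH] f mf /=; first exact: measurable_cst.
apply: measurable_fun_pair; first exact: mf.
apply: IH => i; under eq_fun do rewrite mxE; exact: mf.
Qed.

Lemma measurable_affine n (A : 'M[R]_n) (c : 'cV[R]_n) i :
  measurable_fun setT (fun s : sfs_type (lebesgue_space R n) =>
    (A *m (lebesgue_vec s - c)) i 0 : measurableTypeR R).
Proof.
under eq_fun do rewrite mxE.
apply: measurable_sum => j; apply: measurable_funM => //.
under eq_fun do rewrite !mxE.
apply: measurable_funB => //; exact: measurable_lebesgue_vec.
Qed.

(** In the iterated product, a triangular affine map shears the first coordinate and
    acts on the remaining ones as a triangular affine map of smaller size. *)
Lemma measure_trig_affine n (A : 'M[R]_n) (c : 'cV[R]_n) :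
  is_trig_mx A^T -> (forall i, 0 < A i i) -> forall B, measurable B ->
  sfs_measure (lebesgue_space R n)
     ((fun s => lebesgue_point (A *m (lebesgue_vec s - c))) @^-1` B)
  = ((\det A)^-1%:E * sfs_measure (lebesgue_space R n) B)%E.
Proof.
elim: n A c => [|n IH] A c Atrig Ap B mB.
  rewrite det_mx00 invr1 mul1e; congr (sfs_measure _ _).
  by apply/seteqP; split=> -[].
have A0 (i j : 'I_n.+1) : (j < i)%N -> A i j = 0.
  by move=> ji; rewrite -(is_trig_mxP Atrig j i ji) mxE.
pose A' : 'M[R]_n := \matrix_(i, j) A (lift ord0 i) (lift ord0 j).
pose c' : 'cV[R]_n := \col_i c (lift ord0 i) 0.
have A't : is_trig_mx A'^T.
  by apply/is_trig_mxP => i j ij; rewrite !mxE A0 // !lift0.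
have A'p i : 0 < A' i i by rewrite mxE.
pose l (z : sfs_type (lebesgue_space R n)) : measurableTypeR R :=
  \sum_j A 0 (lift ord0 j) * (lebesgue_vec z j 0 - c' j 0) - A 0 0 * c 0 0.
have ml : measurable_fun setT l.
  apply: measurable_funB => //; apply: measurable_sum => j.
  apply: measurable_funM => //; apply: measurable_funB => //.
  exact: measurable_lebesgue_vec.
pose g z := lebesgue_point (A' *m (lebesgue_vec z - c')).
have mg : measurable_fun setT g.
  by apply: measurable_lebesgue_point => i; exact: measurable_affine.
have detE : \det A = A 0 0 * \det A'.
  rewrite -det_tr -(det_tr A') !det_trig //.
  rewrite big_ord_recl !mxE; congr (_ * _); apply: eq_bigr => i _.
  by rewrite !mxE.
have FE (p : sfs_type (lebesgue_space R n.+1)) :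
    lebesgue_point (A *m (lebesgue_vec p - c)) = (A 0 0 * p.1 + l p.2, g p.2).
  rewrite /=; congr pair.
    rewrite mxE big_ord_recl; under eq_bigr do rewrite !mxE liftK /=.
    rewrite !mxE unlift_none /= /l; under [in RHS]eq_bigr do rewrite !mxE.
    ring.
  congr lebesgue_point; apply/colP => i; rewrite !mxE big_ord_recl.
  rewrite A0 ?mul0r ?add0r //.
  by apply: eq_bigr => j _; rewrite !mxE liftK.
rewrite detE.
under eq_fun do rewrite FE.
apply: (@shear_measure _ _ _ (sfs_measure (lebesgue_space R n))) => //.
- by rewrite det_upper_trig_gt0.
- exact: IH.
Qed.

End Volume.

(** * Volumes of ellipsoids *)

Section EllipsoidVolume.
Variable R : realType.

Lemma unit_ballE n : @unit_ball R n = [set v | dot v v <= 1].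
Proof.
apply/seteqP; split=> v /=; rewrite /unit_ball /= -norm2_sqr.
  by move=> v1; rewrite exprn_ile1 // sqrtr_ge0.
by rewrite -[leRHS](expr1n R 2) ler_pXn2r // ?nnegrE ?sqrtr_ge0.
Qed.

Lemma measurable_unit_ball n :
  measurable (@lebesgue_vec R n @^-1` @unit_ball R n).
Proof.
rewrite unit_ballE; pose f (s : sfs_type (lebesgue_space R n)) : measurableTypeR R :=
  dot (lebesgue_vec s) (lebesgue_vec s).
have mf : measurable_fun setT f.
  apply: measurable_sum => i.
  by apply: measurable_funM; exact: measurable_lebesgue_vec.
have := mf measurableT _ (@measurable_itv R `]-oo, 1]); rewrite setTI.
by congr measurable; apply/seteqP; split=> s /=; rewrite in_itv.
Qed.

(** With X = A^T A, the ellipsoid is the preimage of the unit ball under the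
    triangular affine map v |-> A (v - c). *)
Lemma vol_ellipsoid n (X : 'M[R]_n) (c : 'cV[R]_n) : positive_definite X ->
  vol (ellipsoid X c) = ((Num.sqrt (\det X))^-1%:E * vol (@unit_ball R n))%E.
Proof.
move=> Xp; have [A [XE At Ap]] := cholesky Xp.
have -> : Num.sqrt (\det X) = \det A.
  by rewrite XE det_mulmx det_tr -expr2 sqrtr_sqr gtr0_norm // det_upper_trig_gt0.
have XQ v : dot (X *m v) v = dot (A *m v) (A *m v).
  by rewrite XE -mulmxA [LHS]dot_mulmxl trmxK.
rewrite !volE -(measure_trig_affine c At Ap (measurable_unit_ball n)).
congr (sfs_measure _ _); apply/seteqP; split=> s /=;
  by rewrite unit_ballE /= lebesgue_pointK /ellipsoid /= XQ.
Qed.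

Lemma box_measure n (r : R) : 0 <= r ->
  let B := [set s | forall i, `|@lebesgue_vec R n s i 0| <= r] in
  measurable B /\ sfs_measure (lebesgue_space R n) B = ((2 * r) ^+ n)%:E.
Proof.
move=> r0 /=; elim: n => [|n [mB IH]].
  rewrite (_ : [set _ | _] = setT); last by apply/seteqP; split=> // s _ [].
  by split; [exact: measurableT | rewrite /= diracT].
set B := [set _ | _] in mB IH.
have -> : [set s | forall i, `|@lebesgue_vec R n.+1 s i 0| <= r]
    = `[- r, r]%classic `*` B.
  apply/seteqP; split=> s /= h.
    split=> [|i /=]; last by rewrite -lebesgue_vecS.
    by rewrite /= in_itv /= -ler_norml -lebesgue_vec0.
  move=> i; case: h => /=; rewrite in_itv /= -ler_norml => h1 h2.
  case: (unliftP ord0 i) => [j ->|->]; first by rewrite lebesgue_vecS; exact: h2.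
  by rewrite lebesgue_vec0.
split; first by apply: measurableX => //; exact: measurable_itv.
have mI : measurable (`[- r, r]%classic : set (measurableTypeR R)).
  exact: measurable_itv.
transitivity (lebesgue_measure (`[(- r)%R, r]%classic : set R) *
  sfs_measure (lebesgue_space R n) B)%E; first exact: product_measure1E.
rewrite IH lebesgue_measure_itv /= lte_fin -EFinD opprK exprS -mulr2n -(mulr_natl r).
case: ltP => [_|rr]; first by rewrite -EFinM.
have -> : r = 0 by lra.
by rewrite mul0e mulr0 mul0r.
Qed.

(** The ball lies between the cubes of half-sides 1 / (n + 1) and 1. *)
Lemma vol_unit_ball n : (0 < vol (@unit_ball R n) < +oo)%E.
Proof.
have nR : 0 <= n%:R :> R by [].
pose r : R := n.+1%:R^-1.
have r0 : 0 < r by rewrite invr_gt0.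
have [mB1 B1] := @box_measure n 1 ler01.
have [mBr Br] := @box_measure n r (ltW r0).
rewrite volE; apply/andP; split.
  apply: (@lt_le_trans _ _ ((2 * r) ^+ n)%:E).
    by rewrite lte_fin exprn_gt0 // mulr_gt0.
  rewrite -Br; apply: le_measure; rewrite ?inE //; first exact: measurable_unit_ball.
  move=> s /= sr; rewrite unit_ballE /=.
  apply: le_trans (_ : n%:R * r ^+ 2 <= 1).
    rewrite /dot; apply: le_trans (_ : \sum_(i < n) r ^+ 2 <= _); last first.
      by rewrite sumr_const card_ord -(mulr_natl (r ^+ 2)).
    apply: ler_sum => i _; rewrite -expr2 -real_normK ?num_real //.
    by rewrite ler_pXn2r ?nnegrE // ltW.
  rewrite /r exprVn ler_pdivrMr ?exprn_gt0 // mul1r -natr1 expr2; nra.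
apply: (@le_lt_trans _ _ ((2 * 1 : R) ^+ n)%:E); last by rewrite ltry.
rewrite -B1; apply: le_measure; rewrite ?inE //; first exact: measurable_unit_ball.
move=> s; rewrite unit_ballE /= => s1 i.
rewrite -(@ler_pXn2r _ 2) ?nnegrE // real_normK ?num_real // expr1n.
apply: le_trans s1; rewrite /dot (bigD1 i) //= -expr2 lerDl sumr_ge0 // => j _.
by rewrite -expr2 sqr_ge0.
Qed.

End EllipsoidVolume.

(** * The minimal ellipsoid *)

Section MinimalEllipsoid.
Variables (R : realType) (N M : nat) (Phi : 'I_M -> 'cV[R]_N).

(** Adding up the two inequalities gives <X v, v> + <X c, c> <= 1: a symmetric set can
    be enclosed by translating the ellipsoid to the origin. *)
Lemma dot_le1_of_sym (X : 'M[R]_N) (c v : 'cV[R]_N) : positive_definite X ->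
  ellipsoid X c v -> ellipsoid X c (- v) -> dot (X *m v) v <= 1.
Proof.
rewrite /ellipsoid /= => /pd_psd[XT Xp] h1 h2; have := Xp c.
move: h1 h2; rewrite -opprD mulmxN dotNl dotNr opprK.
rewrite mulmxBr mulmxDr !(dotDl, dotDr, dotNl, dotNr).
lra.
Qed.

Lemma convex_ellipsoid0 (X : 'M[R]_N) : psd X ->
  @convex_set R 'cV[R]_N (ellipsoid X 0).
Proof.
move=> [XT Xp] x y t; rewrite !inE /ellipsoid /= !subr0 => hx hy.
have t0 : 0 <= t%:num by [].
have t1 : t%:num <= 1 by [].
set s := t%:num in t0 t1.
have -> : conv t x y = s *: (x : 'cV[R]_N) + (1 - s) *: (y : 'cV[R]_N) by [].
have := Xp (x - y); move: hx hy.
rewrite mulmxBr mulmxDr -!scalemxAr !(dotDl, dotDr, dotNl, dotNr, dotZl, dotZr).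
rewrite (dot_mulmxl X y x) XT (dotC y).
set a := dot (X *m x) x; set b := dot (X *m y) y; set e := dot (X *m x) y.
move=> ha hb he.
have : 0 <= s * (1 - s) * (a - 2 * e + b) by rewrite !mulr_ge0 //; lra.
have : s * a <= s by rewrite ler_piMr.
have : (1 - s) * b <= 1 - s by rewrite ler_piMr // subr_ge0.
lra.
Qed.

Lemma sym_hull_sub (X : 'M[R]_N) : psd X ->
  (forall i, dot (X *m Phi i) (Phi i) <= 1) -> sym_hull Phi `<=` ellipsoid X 0.
Proof.
move=> Xp h; apply: smallest_sub; first exact: convex_ellipsoid0.
move=> _ [] [i _ <-]; rewrite /ellipsoid /= subr0 //.
by rewrite mulmxN dotNl dotNr opprK.
Qed.

Lemma sym_hull_le1 (X : 'M[R]_N) c : positive_definite X ->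
  sym_hull Phi `<=` ellipsoid X c -> forall i, dot (X *m Phi i) (Phi i) <= 1.
Proof.
move=> Xp h i; apply: (dot_le1_of_sym Xp (c := c)); apply: h.
  by apply: sub_gen_smallest; left; exists i.
by apply: sub_gen_smallest; right; exists i.
Qed.

(** Weak duality bounds the volume of every competitor from below, and the leverage
    condition says that the ellipsoid of Y^-1 reaches this bound. All minimal
    ellipsoids have the same volume, so the value does not depend on the chosen
    one. *)
Lemma frameV_det (c : 'I_M -> R) : (0 < N)%N ->
  (forall i, 0 <= c i) -> \sum_i c i = N%:R ->
  positive_definite (frame_op Phi c) ->
  (forall i, dot (invmx (frame_op Phi c) *m Phi i) (Phi i) <= 1) ->
  frameV Phi = Num.sqrt (\det (frame_op Phi c)).
Proof.
move=> N0 c0 cN Yp lev; set Y := frame_op Phi c in Yp lev *.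
have [b0 boo] := andP (vol_unit_ball R N); set beta := vol _ in b0 boo.
have betaE : beta = (fine beta)%:E.
  by rewrite fineK // ge0_fin_numE // ltW.
have beta0 : 0 < fine beta by rewrite -lte_fin -betaE.
have dY := pd_det_gt0 Yp; have Xp := pd_inv Yp.
have volX (X : 'M[R]_N) d : positive_definite X ->
    vol (ellipsoid X d) = ((Num.sqrt (\det X))^-1 * fine beta)%:E.
  by move=> Xpd; rewrite vol_ellipsoid // -/beta EFinM -betaE.
have volY : vol (ellipsoid (invmx Y) 0) = (Num.sqrt (\det Y) * fine beta)%:E.
  by rewrite volX // det_inv sqrtrV ?(ltW dY) // invrK.
have lower X d : positive_definite X -> sym_hull Phi `<=` ellipsoid X d ->
    (vol (ellipsoid (invmx Y) 0) <= vol (ellipsoid X d))%E.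
  move=> Xpd /(sym_hull_le1 Xpd) le1; rewrite volY volX // lee_fin ler_pM2r //.
  have dX := pd_det_gt0 Xpd.
  have : \det X * \det Y <= 1.
    apply: pd_trace_det_le1 => //; first exact: pd_psd.
    rewrite mxtrace_frame_op -cN; apply: ler_sum => i _.
    by rewrite ler_piMr.
  rewrite -ler_pdivlMl // mulr1 -sqrtrV ?(ltW dX) // => le.
  by rewrite ler_sqrt // invr_ge0 ltW.
have min0 : is_minimal_ellipsoid Phi (ellipsoid (invmx Y) 0).
  split; first by exists (invmx Y), 0.
    by apply: sym_hull_sub => //; exact: pd_psd.
  by move=> _ [X [d [Xpd ->]]]; exact: lower.
have [[X [d [Xpd EX]]] hullX minX] :=
  xgetPex set0 (ex_intro (is_minimal_ellipsoid Phi) _ min0).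
have : vol (minimal_ellipsoid Phi) = vol (ellipsoid (invmx Y) 0).
  apply/eqP; rewrite eq_le; apply/andP; split.
    by case: min0 => E0 h0 _; exact: minX.
  by rewrite /minimal_ellipsoid EX; apply: lower; rewrite // -EX.
rewrite /frameV => ->; rewrite volY -/beta /= mulfK // gt_eqF //.
Qed.

End MinimalEllipsoid.

(** * Bounds between volume and distance *)

Section Bounds.
Variables (R : realType) (N M : nat) (Phi : 'I_M -> 'cV[R]_N).
Hypotheses (N2 : (2 <= N)%N) (PhiUF : unit_norm_frame Phi).

Let N0 : (0 < N)%N. Proof. exact: ltnW. Qed.
Let NR : 1 < N%:R :> R. Proof. by rewrite ltr1n. Qed.
Let PhiF : is_frame Phi. Proof. by case: PhiUF. Qed.
Let PhiU : unit_norm Phi. Proof. by case: PhiUF. Qed.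

Local Notation D2 := (frameD Phi ^+ 2).
Local Notation W := (frameV Phi `^ (4%:R / N%:R)).

Lemma frameV_design : exists Y : 'M[R]_N,
  [/\ frameV Phi = Num.sqrt (\det Y), 0 < \det Y,
      exists2 c : 'I_M -> R, (forall i, 0 <= c i) /\ \sum_i c i = N%:R &
                             Y = frame_op Phi c &
      forall c : 'I_M -> R, (forall i, 0 <= c i) -> \sum_i c i = N%:R ->
        \det (frame_op Phi c) <= \det Y].
Proof.
have [c [c0 cN Yp cmax]] := max_det_attained N0 PhiF.
exists (frame_op Phi c); split=> //; last by exists c.
  by apply: frameV_det => //; exact: (max_det_leverage N0 PhiU c0 cN Yp cmax).
exact: pd_det_gt0.
Qed.

Lemma frameV_gt0 : 0 < frameV Phi.
Proof. by have [Y [-> Y0 _ _]] := frameV_design; rewrite sqrtr_gt0. Qed.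

Lemma frameD_ge0 : 0 <= frameD Phi.
Proof. by have [c _ [-> _]] := frameD_attained PhiU; exact: sqrtr_ge0. Qed.

Lemma powR_frameV p : 0 < p -> frameV Phi = Num.sqrt p -> W = (p ^+ 2) `^ N%:R^-1.
Proof.
move=> p0 ->; rewrite -powR12_sqrt ?ltW // -powRrM -(powR_mulrn 2 (ltW p0)) -powRrM.
by congr powR; rewrite mulrA; congr (_ / _); field.
Qed.

Lemma powR_expnK (x : R) : 0 <= x -> (x ^+ N) `^ N%:R^-1 = x.
Proof.
move=> x0; rewrite -powR_mulrn // -powRrM divff ?powRr1 //.
by rewrite pnatr_eq0 -lt0n.
Qed.

Lemma powR_root_le (p q : R) : 0 <= p -> p <= q -> p `^ N%:R^-1 <= q `^ N%:R^-1.
Proof.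
move=> p0 pq; apply: ge0_ler_powR; rewrite ?nnegrE ?invr_ge0 //.
exact: le_trans pq.
Qed.

Lemma frameD_scale (c : 'I_M -> R) (a : R) : (forall i, 0 <= c i) -> 0 <= a ->
  D2 <= a ^+ 2 * normF (frame_op Phi c) ^+ 2 - 2 * a * \sum_i c i + N%:R.
Proof.
move=> c0 a0; have [_ _ [_ Dmin]] := frameD_attained PhiU.
have ac0 i : 0 <= a * c i by rewrite mulr_ge0.
have := Dmin _ ac0.
rewrite -(@ler_pXn2r _ 2) ?nnegrE ?frameD_ge0 ?sqrtr_ge0 //.
rewrite normF_frame_op // -mulr_sumr -frame_opZ mulrA.
suff -> : normF (a *: frame_op Phi c) ^+ 2 = a ^+ 2 * normF (frame_op Phi c) ^+ 2 by [].
rewrite !normF_sqr_sum mulr_sumr; apply: eq_bigr => i _.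
by rewrite mulr_sumr; apply: eq_bigr => j _; rewrite mxE exprMn.
Qed.

(** The minimizer c is also optimal on its ray: the quadratic polynomial
    a^2 |T|^2 - 2 a tr T + N has its minimum over a >= 0 at a = 1. *)
Lemma frameD_trace : exists2 c : 'I_M -> R, forall i, 0 <= c i &
  \sum_i c i = N%:R - D2 /\ normF (frame_op Phi c) ^+ 2 = N%:R - D2.
Proof.
have [c c0 [DE _]] := frameD_attained PhiU; exists c => //.
have D2E := congr1 (fun x => x ^+ 2) DE; rewrite /= normF_frame_op // in D2E.
set n := normF _ ^+ 2 in D2E *; set t := \sum_i _ in D2E *.
have t0 : 0 <= t by apply: sumr_ge0.
have n0 : 0 <= n by exact: sqr_ge0.
suff nt : n = t by rewrite nt in D2E *; split; rewrite D2E; ring.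
have [nz|nz] := eqVneq n 0.
  have := sqr_mxtrace_le (frame_op Phi c); rewrite mxtrace_frame_op1 //.
  rewrite -/n -/t nz mulr0.
  by move=> tle; apply/esym/eqP; rewrite -sqrf_eq0 eq_le tle sqr_ge0.
have n1 : 0 < n by rewrite lt_def nz.
have := frameD_scale c0 (divr_ge0 t0 n0); rewrite -/n -/t D2E.
have -> : (t / n) ^+ 2 * n - 2 * (t / n) * t + N%:R = N%:R - t ^+ 2 / n by field.
rewrite -subr_ge0.
have -> : N%:R - t ^+ 2 / n - (n - 2 * t + N%:R) = - (n - t) ^+ 2 / n by field.
rewrite pmulr_lge0 ?invr_gt0 // oppr_ge0 => le.
by apply/eqP; rewrite -subr_eq0 -sqrf_eq0 eq_le le sqr_ge0.
Qed.

(** The distance from I to the ray of Y is reached at Y scaled by N / |Y|^2. *)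
Lemma design_normF (c : 'I_M -> R) : (forall i, 0 <= c i) -> \sum_i c i = N%:R ->
  D2 < N%:R /\ N%:R ^+ 2 / (N%:R - D2) <= normF (frame_op Phi c) ^+ 2.
Proof.
move=> c0 cN; set n := normF _ ^+ 2.
have n1 : 0 < n.
  have := sqr_mxtrace_le (frame_op Phi c); rewrite mxtrace_frame_op1 // cN -/n => le.
  rewrite -(@pmulr_rgt0 _ N%:R) ?ltr0n //; apply: lt_le_trans le.
  by rewrite exprn_gt0 // ltr0n.
have := frameD_scale c0 (divr_ge0 (ler0n R N) (ltW n1)); rewrite -/n cN.
have -> : (N%:R / n) ^+ 2 * n - 2 * (N%:R / n) * N%:R + N%:R
    = N%:R - N%:R ^+ 2 / n :> R by field; rewrite gt_eqF.
move=> le; have q0 : 0 < N%:R ^+ 2 / n by rewrite divr_gt0 // exprn_gt0 // ltr0n.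
have d0 : 0 < N%:R - D2 by lra.
split; first lra.
have : N%:R ^+ 2 / n <= N%:R - D2 by lra.
by rewrite !ler_pdivrMr // mulrC.
Qed.

Lemma frameD_sqr_lt : D2 < N%:R.
Proof.
have [Y [_ _ [c [c0 cN] _] _]] := frameV_design.
by have [] := design_normF c0 cN.
Qed.

Lemma frameV_upper :
  W <= N%:R * (N%:R - 1 - D2) / ((N%:R - 1) * (N%:R - D2)).
Proof.
have N1 := NR.
have [Y [VE Y0 [c [c0 cN] YE] _]] := frameV_design.
have [d2 nlo] := design_normF c0 cN; rewrite -YE in nlo.
have Yp : psd Y by rewrite YE; exact: frame_op_psd.
have := psd_sqr_det_le N2 Yp; have := psd_normF_le_trace Yp.
have -> : \tr Y = N%:R by rewrite YE mxtrace_frame_op1.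
set n := normF Y ^+ 2 in nlo * => nhi.
set w := (N%:R ^+ 2 - n) / _ => le.
have NN : 0 < N%:R * (N%:R - 1) :> R by rewrite mulr_gt0 //; lra.
have w0 : 0 <= w by rewrite divr_ge0 ?subr_ge0 // ltW.
rewrite (powR_frameV Y0 VE); apply: le_trans (powR_root_le (sqr_ge0 _) le) _.
rewrite powR_expnK; last exact: w0.
have Nd : 0 < N%:R - D2 by rewrite subr_gt0.
apply: le_trans (_ : (N%:R ^+ 2 - N%:R ^+ 2 / (N%:R - D2)) / (N%:R * (N%:R - 1)) <= _).
  by rewrite ler_pM2r ?invr_gt0 // lerD2l lerN2.
rewrite le_eqVlt; apply/orP; left; apply/eqP; field.
by rewrite !gt_eqF ?subr_gt0 // ltr0n.
Qed.

Lemma frameV_lower : frameD Phi < 1 ->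
  N%:R * (1 - D2) / (N%:R - D2) <= W.
Proof.
have N1 := NR.
move=> D1; have [Y [VE Y0 _ Ymax]] := frameV_design.
have [c c0 [cs cn]] := frameD_trace.
have d01 : 0 <= D2 < 1 by rewrite sqr_ge0 expr_lt1 // frameD_ge0.
have /andP[d0 d1] := d01.
have [detT T0] := psd_sqr_det_ge N0 (frame_op_psd Phi c0) d01
  (etrans (mxtrace_frame_op1 PhiU c) cs) cn.
set d2 := D2 in cs cn detT d01 d0 d1 *.
have Nd : 0 < N%:R - d2 by lra.
set a := N%:R / (N%:R - d2).
have a0 : 0 < a by rewrite divr_gt0 // ltr0n.
have ac0 i : 0 <= a * c i by rewrite mulr_ge0 // ltW.
have acN : \sum_i a * c i = N%:R by rewrite -mulr_sumr cs /a divfK // gt_eqF.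
have := Ymax _ ac0 acN; rewrite -frame_opZ detZ => le.
have x0 : 0 <= N%:R * (1 - d2) / (N%:R - d2).
  by rewrite divr_ge0 ?mulr_ge0 ?ler0n //; lra.
rewrite (powR_frameV Y0 VE) -[leLHS]powR_expnK //.
apply: powR_root_le; first exact: exprn_ge0.
apply: le_trans (_ : (a ^+ N * \det (frame_op Phi c)) ^+ 2 <= _); last first.
  by rewrite ler_pXn2r ?nnegrE ?(ltW Y0) // mulr_ge0 ?exprn_ge0 ?(ltW a0) ?(ltW T0).
have -> : N%:R * (1 - d2) / (N%:R - d2) = a ^+ 2 * ((N%:R - d2) / N%:R * (1 - d2)).
  by rewrite /a; field; rewrite !gt_eqF // ltr0n.
by rewrite exprMn [leRHS]exprMn exprAC ler_pM2l // !exprn_gt0.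
Qed.

Lemma upper_bound_le1 :
  N%:R * (N%:R - 1 - D2) / ((N%:R - 1) * (N%:R - D2)) <= 1.
Proof.
have N1 := NR.
have d2 := frameD_sqr_lt; have d0 := sqr_ge0 (frameD Phi).
have Nd : 0 < N%:R - D2 by rewrite subr_gt0.
rewrite ler_pdivrMr ?mulr_gt0 //; last lra.
rewrite mul1r -subr_ge0.
by have -> : (N%:R - 1) * (N%:R - D2) - N%:R * (N%:R - 1 - D2) = D2 by ring.
Qed.

Lemma frameV_le1 : frameV Phi <= 1.
Proof.
have W1 := le_trans frameV_upper upper_bound_le1.
rewrite leNgt; apply/negP => V1; move: W1; rewrite leNgt => /negP; apply.
have e0 : 0 < 4%:R / N%:R :> R by rewrite divr_gt0 // ltr0n.
have := gt0_ltr_powR e0 _ _ V1; rewrite powR1; apply; rewrite nnegrE //.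
exact/ltW/frameV_gt0.
Qed.

(** As V <= 1 and N / 4 <= N, the integral power N of V^(4/N) is at most V; this
    turns the lower bound into one on V by a rational function of D. *)
Lemma frameV_ge_expn : frameD Phi < 1 ->
  (N%:R * (1 - D2) / (N%:R - D2)) ^+ N <= frameV Phi.
Proof.
move=> D1; have V0 := frameV_gt0; have low := frameV_lower D1.
have d2 := frameD_sqr_lt; have d0 := frameD_ge0.
have x0 : 0 <= N%:R * (1 - D2) / (N%:R - D2).
  rewrite divr_ge0 ?mulr_ge0 ?ler0n ?subr_ge0 // ?(ltW d2) //.
  by rewrite exprn_ile1 // ltW.
apply: le_trans (_ : W ^+ N <= _).
  by rewrite ler_pXn2r ?nnegrE ?powR_ge0.
rewrite -powR_mulrn ?powR_ge0 // -powRrM divfK ?pnatr_eq0 -?lt0n //.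
rewrite -[leRHS](powRr1 (ltW V0)) ger_powR ?V0 ?frameV_le1 //.
by rewrite ler1n.
Qed.

(** The upper bound equals 1 - D^2 / ((N - 1) (N - D^2)), and V^4 <= V^(4/N). *)
Lemma frameD_sqr_le : D2 <= N%:R ^+ 2 * (1 - frameV Phi ^+ 4).
Proof.
have N1 := NR.
have V0 := frameV_gt0; have d2 := frameD_sqr_lt; have d0 := sqr_ge0 (frameD Phi).
have V4 : frameV Phi ^+ 4 <= W.
  rewrite -(powR_mulrn 4 (ltW V0)) ger_powR ?V0 ?frameV_le1 //.
  by rewrite ler_pdivrMr ?ltr0n // ler_peMr // ler1n.
have up := le_trans V4 frameV_upper.
have Nd : 0 < N%:R - D2 by rewrite subr_gt0.
have N1' : 0 < N%:R - 1 :> R by lra.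
apply: le_trans (_ : N%:R ^+ 2 * (D2 / ((N%:R - 1) * (N%:R - D2))) <= _).
  rewrite mulrA ler_pdivlMr ?mulr_gt0 // [leLHS]mulrC ler_wpM2r //.
  rewrite expr2; apply: ler_pM; lra.
rewrite ler_pM2l ?exprn_gt0 ?ltr0n //.
suff : N%:R * (N%:R - 1 - D2) / ((N%:R - 1) * (N%:R - D2))
    = 1 - D2 / ((N%:R - 1) * (N%:R - D2)) by lra.
by field; rewrite !gt_eqF.
Qed.
End Bounds.

Theorem theorem3p3 (R : realType) (N M : nat) (hN : (2 <= N)%N) :
  (forall Phi : 'I_M -> 'cV[R]_N, unit_norm_frame Phi ->
    [/\ frameD Phi < 1 ->
          N%:R * (1 - frameD Phi ^+ 2) / (N%:R - frameD Phi ^+ 2)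
            <= frameV Phi `^ (4%:R / N%:R),
        frameV Phi `^ (4%:R / N%:R)
          <= N%:R * (N%:R - 1 - frameD Phi ^+ 2)
               / ((N%:R - 1) * (N%:R - frameD Phi ^+ 2)) &
        N%:R * (N%:R - 1 - frameD Phi ^+ 2)
          / ((N%:R - 1) * (N%:R - frameD Phi ^+ 2)) <= 1])
  /\
  (forall Phi : nat -> 'I_M -> 'cV[R]_N,
    (forall n, unit_norm_frame (Phi n)) ->
    (frameV (Phi n) @[n --> \oo] --> (1 : R) <->
     frameD (Phi n) @[n --> \oo] --> (0 : R))).
Proof.
split=> [Phi PhiF|Phi PhiF].
  split; [exact: frameV_lower | exact: frameV_upper | exact: upper_bound_le1].
have N0R : N%:R != 0 :> R by rewrite pnatr_eq0 -lt0n ltnW.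
split=> [V1|D0].
  pose g (v : R) := N%:R ^+ 2 * (1 - v ^+ 4).
  have gc : {for 1, continuous g}.
    apply: continuousM; first exact: cst_continuous.
    by apply: continuousB; [exact: cst_continuous | exact: exprn_continuous].
  have g0 : g (frameV (Phi n)) @[n --> \oo] --> (0 : R).
    have : g 1 = 0 by rewrite /g expr1n subrr mulr0.
    by move=> <-; exact: (cvg_comp _ _ V1 gc).
  have Dsqr : frameD (Phi n) ^+ 2 @[n --> \oo] --> (0 : R).
    apply: squeeze_cvgr (cvg_cst 0) g0.
    by apply: nearW => n; rewrite sqr_ge0 frameD_sqr_le.
  have := cvg_comp _ _ Dsqr (@sqrt_continuous R 0); rewrite sqrtr0.
  apply: cvg_trans; apply: near_eq_cvg; apply: nearW => n /=.
  by rewrite sqrtr_sqr ger0_norm // frameD_ge0.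
pose g (x : R) := (N%:R * (1 - x ^+ 2) / (N%:R - x ^+ 2)) ^+ N.
have gc : {for 0, continuous g}.
  have sc (a : R) : {for 0, continuous (fun x : R => a - x ^+ 2)}.
    by apply: continuousB; [exact: cst_continuous | exact: exprn_continuous].
  apply: (@continuous_comp _ _ _ (fun x : R => N%:R * (1 - x ^+ 2) / (N%:R - x ^+ 2))
    (fun x => x ^+ N)); last exact: exprn_continuous.
  apply: continuousM.
    by apply: continuousM; [exact: cst_continuous | exact: sc].
  by apply: continuousV; [rewrite expr0n subr0 | exact: sc].
have g1 : g (frameD (Phi n)) @[n --> \oo] --> (1 : R).
  have : g 0 = 1 by rewrite /g expr0n /= !subr0 mulr1 divff // expr1n.
  by move=> <-; exact: (cvg_comp _ _ D0 gc).
have one : (fun=> 1 : R) n @[n --> \oo] --> (1 : R) by exact: cvg_cst.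
apply: squeeze_cvgr g1 one.
have D1 : \forall n \near \oo, frameD (Phi n) < 1 by exact: (cvgr_lt 0 D0).
apply: filterS D1 => n Dn.
by rewrite frameV_ge_expn // frameV_le1.
Qed.
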